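(* Let $G$ be a connected graph (finite or infinite) with maximum degree $\Delta \ge 3$ (where $\Delta$ may be an infinite cardinal). Suppose $G$ is not a tree and $G$ is isomorphic neither to $K_{3,3}$ nor to $K_4$. Then $D'_l(G)\le \Delta-1$; that is, for every assignment $\{L(e)\}_{e\in E(G)}$ of lists of colours with $|L(e)|=\Delta-1$ for every edge $e$, there exists a distinguishing edge colouring $c$ of $G$ with $c(e)\in L(e)$ for every $e\in E(G)$.
   Context: Graphs are simple. The maximum degree $\Delta$ of a (possibly infinite) graph is the supremum of its vertex degrees; if $\Delta$ is an infinite cardinal, $\Delta-1$ is understood as $\Delta$. An edge colouring $c$ of $G$ is distinguishing if the only automorphism of $G$ preserving $c$ (i.e. mapping every edge to an edge of the same colour) is the identity. The list distinguishing index $D'_l(G)$ is the minimum cardinal $k$ such that for every assignment of lists $L(e)$ of cardinality $k$ to the edges $e$ of $G$ there is a distinguishing edge colouring $c$ with $c(e)\in L(e)$ for all edges $e$. *)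

(* Defs.v *)
From mathcomp Require Import all_boot.
From mathcomp Require Import mathcomp_extra boolp classical_sets functions.
From mathcomp Require Import cardinality.

Set Implicit Arguments.
Unset Strict Implicit.
Unset Printing Implicit Defensive.

Local Open Scope classical_set_scope.
Local Open Scope card_scope.

Record sgraph := SGraph {
  vertex :> eqType;
  adj : rel vertex;
  adj_sym : symmetric adj;
  adj_irr : irreflexive adj }.

Definition edges (G : sgraph) : set (set G) :=
  [set A | exists x y : G, adj x y /\ A = [set x; y]].
Arguments edges : clear implicits.

Definition neighbours (G : sgraph) (x : G) : set G := [set y | adj x y].

Definition graph_connected (G : sgraph) : Prop :=
  forall x y : G, exists2 p : seq G, path (@adj G) x p & y = last x p.

Definition has_cycle (G : sgraph) : Prop :=
  exists2 p : seq G, 3 <= size p & ucycle (@adj G) p.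

Definition is_tree (G : sgraph) : Prop := graph_connected G /\ ~ has_cycle G.

Definition is_isomorphism (G H : sgraph) (f : G -> H) : Prop :=
  bijective f /\ forall x y : G, adj (f x) (f y) = adj x y.

Definition isomorphic (G H : sgraph) : Prop :=
  exists f : G -> H, is_isomorphism f.

Definition is_automorphism (G : sgraph) (f : G -> G) : Prop :=
  is_isomorphism f.

Section CompleteGraphs.
Variables m n : nat.

Definition complete_adj : rel 'I_n := fun x y => x != y.

Lemma complete_adj_sym : symmetric complete_adj.
Proof. by move=> x y; rewrite /complete_adj eq_sym. Qed.

Lemma complete_adj_irr : irreflexive complete_adj.
Proof. by move=> x; rewrite /complete_adj eqxx. Qed.

Definition complete_graph : sgraph :=
  SGraph complete_adj_sym complete_adj_irr.

Definition bipartite_adj : rel ('I_m + 'I_n)%type := fun x y =>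
  match x, y with
  | inl _, inr _ | inr _, inl _ => true
  | _, _ => false
  end.

Lemma bipartite_adj_sym : symmetric bipartite_adj.
Proof. by move=> [x|x] [y|y]. Qed.

Lemma bipartite_adj_irr : irreflexive bipartite_adj.
Proof. by move=> [x|x]. Qed.

Definition complete_bipartite_graph : sgraph :=
  SGraph bipartite_adj_sym bipartite_adj_irr.

End CompleteGraphs.

(* A cardinal is represented by a type having that cardinality. *)

(* [D] represents the supremum of the cardinals of the neighbourhoods. *)
Definition is_max_degree (G : sgraph) (D : Type) : Prop :=
  (forall x : G, neighbours x #<= [set: D]) /\
  (forall D' : Type, (forall x : G, neighbours x #<= [set: D']) ->
     [set: D] #<= [set: D']).

(* [K] represents [D] - 1, with the convention [D] - 1 = [D] if [D] is
   infinite. *)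
Definition is_pred_cardinal (D K : Type) : Prop :=
  (forall n : nat, [set: D] #= `I_n -> [set: K] #= `I_n.-1) /\
  (infinite_set [set: D] -> [set: K] #= [set: D]).

Definition preserves_colouring (G : sgraph) (C : Type) (c : edges G -> C)
    (f : G -> G) : Prop :=
  forall e e' : edges G, val e' = f @` val e -> c e' = c e.

Definition distinguishing (G : sgraph) (C : Type) (c : edges G -> C) : Prop :=
  forall f : G -> G, is_automorphism f -> preserves_colouring c f -> f =1 id.

Definition list_distinguishable (G : sgraph) (K : Type) : Prop :=
  forall (C : Type) (L : edges G -> set C),
    (forall e, L e #= [set: K]) ->
    exists c : edges G -> C, (forall e, L e (c e)) /\ distinguishing c.

(* [K] represents the minimum of the cardinals [k] such that [G] has a
   distinguishing colouring from all lists of cardinality [k]. *)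
Definition is_list_distinguishing_index (G : sgraph) (K : Type) : Prop :=
  list_distinguishable G K /\
  (forall K' : Type, list_distinguishable G K' -> [set: K] #<= [set: K']).

(* Main.v *)
Require Import Defs.
From mathcomp Require Import all_boot zify.
From mathcomp Require Import mathcomp_extra boolp classical_sets functions.
From mathcomp Require Import cardinality wochoice.

(** Fix a finite set [B] of vertices, take the breadth-first levels from [B] and
    let every vertex outside [B] choose a parent one level up.  If the edges from
    each vertex to its children have distinct colours, a colour-preserving
    automorphism fixing [B] pointwise is the identity.

    Infinite maximum degree: [B] is a path [a, r, b], and its two edges receive
    two colours used nowhere else.

    Finite maximum degree [k + 1]: well-order the colours and let the key of an
    edge be the least colour of its list.  Consider the paths [b 0, ..., b g] with
    [b 1] adjacent to [b g] (a cycle with a pendant edge, its closing edge left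
    aside) and take one whose sequence of keys is minimal.  Colour its edges by
    their keys, the edges outside the tree by other colours, and the child edges
    injectively, again avoiding keys, which fails for at most one child, and only
    at vertices with [k] children.  By minimality every colour-preserving
    automorphism maps the path to a path of edges coloured by their keys.  Such
    edges form disjoint descending paths whose inner vertices have no neighbours
    except their parent and their children, and so they contain no other copy of
    the path whose ends are closed up.  The only obstruction is an edge joining
    [b 0] to [b g.-1]: if [k >= 3] it can be given a colour different from that of
    the closing edge, and if [k = 2] it can be avoided by another choice of the
    path, except in [K_4], [K_{3,3}] and [K_{2,3}]. *)
Set Implicit Arguments.
Unset Strict Implicit.
Unset Printing Implicit Defensive.

Local Open Scope classical_set_scope.
Local Open Scope card_scope.


(** * Cardinals *)

Lemma card_le_injP (T U : Type) (A : set T) (B : set U) :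
  A #<= B <-> exists f : A -> B, injective f.
Proof.
split=> [/card_leP[f]|[f f_inj]]; first by exists f => x y e; apply: (inj _ _ e); rewrite inE.
have [g] : $|{injfun [set: A] >-> [set: B]}|.
  by apply/injfunPex; exists f => // x y _ _; exact: f_inj.
by apply/card_leP; squash g.
Qed.

Lemma card_leT_injP (T U : Type) :
  [set: T] #<= [set: U] <-> exists f : T -> U, injective f.
Proof.
rewrite card_le_injP; split=> [[f f_inj]|[f f_inj]].
  exists (fun x => val (f (SigSub (mem_set (I : [set: T] x))))) => x y.
  by move=> /val_inj/f_inj[].
exists (fun x => SigSub (mem_set (I : [set: U] (f (val x))))) => x y [].
by move=> /f_inj/val_inj.
Qed.

Lemma card_le_injfun (T U : Type) (A : set T) (B : set U) (f : T -> U) :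
  (forall x, A x -> B (f x)) -> (forall x y, A x -> A y -> f x = f y -> x = y) ->
  A #<= B.
Proof.
move=> fAB f_inj; apply/card_le_injP.
exists (fun x : A => SigSub (mem_set (fAB _ (set_valP x)))) => x y [/f_inj e].
by apply: val_inj; apply: e; exact: set_valP.
Qed.

(* A subset of the product that is maximal among those on which every
   projection is injective has a surjective projection. *)
Lemma exists_least_card (I : Type) (T : I -> Type) : I ->
  exists i, forall j, [set: T i] #<= [set: T j].
Proof.
move=> i0; pose P (S : set (forall i, T i)) :=
  forall i x y, S x -> S y -> x i = y i -> x = y.
have [F FP F_total|S [SP S_max]] := @Zorn_bigcup _ P.
  move=> i x y [A FA Ax] [B FB By] xy.
  have [AB|BA] := F_total _ _ FA FB.
    by apply: (FP _ FB i) => //; exact: AB.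
  by apply: (FP _ FA i) => //; exact: BA.
have [[i S_surj]|noS] := pselect (exists i, forall t : T i, exists2 x, S x & x i = t).
  exists i => j; apply/card_leT_injP.
  have {}S_surj t : {x | S x & x i = t} by apply: cid2.
  exists (fun t => s2val (S_surj t) j) => t u.
  case: (S_surj t) (S_surj u) => x Sx xt [y Sy yu] /= /(SP _ _ _ Sx Sy) xy.
  by rewrite -xt -yu xy.
have miss i : {t : T i | forall x, S x -> x i <> t}.
  apply: cid; apply: contrapT => nt; apply: noS; exists i => t.
  apply: contrapT => tS; apply: nt; exists t => x Sx xt; apply: tS.
  by exists x.
pose z i := sval (miss i).
have zN x i : S x -> x i <> z i by rewrite /z; case: (miss i) => t /= + /[dup] => h /h.
exfalso; apply: (S_max (S `|` [set z])).
  split; last by move=> h; exact: (zN z i0 (h z (or_intror erefl))).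
  by move=> x Sx; left.
move=> i x y [Sx|->] [Sy|->] //; first exact: SP.
  by move=> /(zN _ _ Sx).
by move=> /esym /(zN _ _ Sy).
Qed.

Lemma card_le_total (T U : Type) : [set: T] #<= [set: U] \/ [set: U] #<= [set: T].
Proof.
have [[] le] := @exists_least_card bool (fun b => if b then T else U) true.
  by left; exact: (le false).
by right; exact: (le true).
Qed.

Lemma card_le_infinite_setD1 (T : Type) (A : set T) (x : T) :
  infinite_set A -> A #<= A `\ x.
Proof.
move=> Aoo; have := infinite_setD Aoo (finite_set1 x).
rewrite infiniteP => /card_le_injP[g0 g0_inj].
pose g n : T := val (g0 (SigSub (mem_set (I : [set: nat] n)))).
have g_inj : injective g by move=> m n /val_inj/g0_inj[].
have gA n : (A `\ x) (g n) by exact: set_valP.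
(* Hilbert's hotel *)
pose f y := if pselect (y = x) is left _ then g 0 else
  if pselect (exists n, g n = y) is left h then g (sval (cid h)).+1 else y.
apply: (@card_le_injfun _ _ _ _ f) => [y Ay|y z _ _]; rewrite /f.
  by case: pselect => // yx; case: pselect.
case: (pselect (y = x)) => [->|yx]; case: (pselect (z = x)) => [->|zx] //.
- case: pselect => [h|h]; first by case: cid => n /= _ /g_inj.
  by move=> gz; case: h; exists 0.
- case: pselect => [h|h]; first by case: cid => n /= _ /g_inj.
  by move=> gz; case: h; exists 0.
- case: pselect => [h|h]; case: pselect => [h'|h'] //.
  + by case: cid => n /= <-; case: cid => m /= <- /g_inj [->].
  + by move=> gz; case: h'; eexists; exact: gz.
  + by move=> gz; case: h; eexists; symmetry; exact: gz.
Qed.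

Lemma card_le_infinite_setD2 (T : Type) (A : set T) (x y : T) :
  infinite_set A -> A #<= A `\` [set x; y].
Proof.
move=> Aoo; apply: card_le_trans (card_le_infinite_setD1 x Aoo) _.
rewrite -setDDl; apply: card_le_infinite_setD1.
exact: infinite_setD Aoo (finite_set1 x).
Qed.

Lemma exists_well_order (T : Type) : exists W : T -> T -> Prop,
  (forall x y, W x y -> W y x -> x = y) /\
  (forall A : set T, A !=set0 -> exists2 z, A z & forall x, A x -> W z x).
Proof.
have [W W_wo] := well_ordering_principle {classic T}; exists W.
have min (A : set T) : A !=set0 -> exists2 z, A z & forall x, A x -> W z x.
  move=> [a Aa]; have [|z [[zA zmin] _]] := W_wo (fun x => `[< A x >]).
    by exists a; apply/asboolP.
  by exists z => [|x Ax]; [exact/asboolP | apply: zmin; apply/asboolP].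
split=> // x y xy yx.
have [|z [zmin zuniq]] := W_wo (fun t => `[< t = x \/ t = y >]).
  by exists x; apply/asboolP; left.
have W_refl t : W t t.
  by have [|u -> /(_ _ erefl)] := min [set t]; first by exists t.
have zx : z = x.
  by apply: zuniq; split=> [|t /asboolP[]->//]; apply/asboolP; left.
by rewrite -zx; apply: zuniq; split=> [|t /asboolP[]->//]; apply/asboolP; right.
Qed.

(** If some initial segment of a well-order is as large as [I], take the least such segment and pull
    the order back along an injection of [I] into it. By minimality every segment of the new order
    is smaller than [I]. *)
Lemma exists_initial_well_order (I : Type) :
  exists R : I -> I -> Prop, well_founded R /\
    (forall x y, x <> y -> R x y \/ R y x) /\
    (forall i, ~ ([set: I] #<= [set j | R j i])).
Proof.
have [W [W_anti min]] := exists_well_order I.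
pose R (x y : I) := x <> y /\ W x y.
have R_total x y : x <> y -> R x y \/ R y x.
  move=> xy; have [|z zxy zmin] := min [set x; y]; first by exists x; left.
  case: zxy zmin => -> zmin; [left|right]; split=> //.
  - by apply: zmin; right.
  - by move=> /esym.
  - by apply: zmin; left.
have R_wf : well_founded R.
  move=> x; apply: contrapT => nacc.
  have [|z zN zmin] := min [set t | ~ Acc R t]; first by exists x.
  apply: zN; constructor=> y [yz Wyz]; apply: contrapT => /zmin Wzy.
  exact/yz/W_anti.
have [[i Ii]|noseg] := pselect (exists i, [set: I] #<= [set j | R j i]); last first.
  by exists R; split=> //; split=> // i Ii; apply: noseg; exists i.
have [|i0 Ii0 i0_min] := min [set i | [set: I] #<= [set j | R j i]]; first by exists i.
have /card_le_injP[f f_inj] := Ii0.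
pose h i := val (f (SigSub (mem_set (Logic.I : [set: I] i)))).
have h_inj : injective h by move=> x y /val_inj/f_inj[].
have hR x : R (h x) i0 by exact: (set_valP (f (SigSub (mem_set (Logic.I : [set: I] x))))).
exists (fun x y => R (h x) (h y)); split.
  suff acc y : forall x, h x = y -> Acc (fun x y => R (h x) (h y)) x.
    by move=> x; exact: acc erefl.
  elim: (R_wf y) => {}y _ IH x hx; constructor=> z; rewrite hx => Rzy.
  exact: (IH _ Rzy).
split=> [x y xy|x Ix]; first by apply: R_total => /h_inj.
have [hx0 Whx] := hR x; apply: hx0; apply: W_anti => //; apply: i0_min => /=.
by apply: card_le_trans Ix _; apply: (@card_le_injfun _ _ _ _ h) => // ? ? _ _ /h_inj.
Qed.

(** Transfinite recursion along the order just built: fewer values than [I] has elements are taken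
    before stage [i], so [S i] still contains a new one. *)
Lemma exists_injective_choice (I C : Type) (S : I -> set C) :
  (forall i, [set: I] #<= S i) ->
  exists f : I -> C, injective f /\ forall i, S i (f i).
Proof.
move=> IS; have [R [R_wf [R_total R_initial]]] := exists_initial_well_order I.
have [[i0]|noI] := pselect (inhabited I); last first.
  by exists (fun i => False_rect C (noI (inhabits i))); split=> i; case: (noI (inhabits i)).
have /card_le_injP[g _] := IS i0.
pose c0 := val (g (SigSub (mem_set (Logic.I : [set: I] i0)))).
pose step i (rec : forall j, R j i -> C) :=
  xget (c0 : {classic C}) [set x | S i x /\ forall j (ji : R j i), rec j ji <> x].
pose f := Fix R_wf (fun=> C) step.
have fE i : f i = step i (fun j _ => f j).
  apply: (Fix_eq R_wf (fun=> C)) => {}i u v uv; congr (step i _).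
  by apply: functional_extensionality_dep => j; apply: functional_extensionality_dep => ji.
have fP i : S i (f i) /\ forall j, R j i -> f j <> f i.
  suff: exists x, S i x /\ forall j, R j i -> f j <> x by rewrite fE; exact: (@xgetPex {classic C} c0).
  apply: contrapT => nx; apply: (R_initial i).
  apply: card_le_trans (IS i) (card_le_trans _ (card_image_le f _)).
  apply: subset_card_le => x Sx; apply: contrapT => nfx; apply: nx; exists x; split=> // j ji fj.
  by apply: nfx; exists j.
exists f; split=> [x y xy|i]; last by case: (fP i).
apply: contrapT => /R_total[r|r]; first by case: (fP y) => _ /(_ _ r).
by case: (fP x) => _ /(_ _ r); rewrite xy.
Qed.

(** * The minimum in the list distinguishing index *)

Lemma list_distinguishable_card_eq (G : sgraph) (K K' : Type) :
  [set: K] #= [set: K'] -> list_distinguishable G K -> list_distinguishable G K'.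
Proof.
move=> KK' distK C L LK'; apply: distK => e.
exact: card_eq_trans (LK' e) (card_esym KK').
Qed.

(** Minimising over the subsets of [K] is enough: by comparability every [K'] either dominates [K]
    or is in bijection with one of these subsets. *)
Lemma exists_list_distinguishing_index (G : sgraph) (K : Type) :
  list_distinguishable G K ->
  exists2 I : Type, is_list_distinguishing_index G I & [set: I] #<= [set: K].
Proof.
move=> distK; pose P (A : set K) := list_distinguishable G A.
have distT : list_distinguishable G [set: K].
  exact: list_distinguishable_card_eq (card_setT_sym _) distK.
have [[A distA] A_min] := @exists_least_card {A | P A} (fun A => sval A) (exist P _ distT).
have AK : [set: A] #<= [set: K].
  by apply/card_leT_injP; exists val; exact: val_inj.
exists A => //; split=> // K' distK'.
have [KK'|/card_subP[B BK' _]] := card_le_total K K'; first exact: card_le_trans AK KK'.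
have distB : list_distinguishable G B.
  apply: list_distinguishable_card_eq distK'.
  exact: card_eq_trans (card_esym BK') (card_setT_sym _).
apply: card_le_trans (A_min (exist P _ distB)) _ => /=.
by rewrite (card_le_eql (card_setT _)) (card_le_eql BK').
Qed.


(** * Breadth-first trees *)

Lemma set2_eq (T : Type) (a b x y : T) : [set a; b] = [set x; y] ->
  (a = x /\ b = y) \/ (a = y /\ b = x).
Proof.
move=> e.
have : [set x; y] a by rewrite -e; left.
have : [set x; y] b by rewrite -e; right.
have : [set a; b] x by rewrite e; left.
have : [set a; b] y by rewrite e; right.
by move=> [] /= h1 [] /= h2 [] /= h3 [] /= h4; intuition congruence.
Qed.

(** Indexes the lists by ordered pairs of vertices; the value is empty when the pair is not an
    edge. *)
Definition edge_list (G : sgraph) (C : Type) (L : edges G -> set C) (x y : G) :=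
  [set a | exists2 e : edges G, val e = [set x; y] & L e a].

Lemma edge_listC G C (L : edges G -> set C) x y : edge_list L x y = edge_list L y x.
Proof. by rewrite /edge_list setUC. Qed.

Lemma edge_listE G C (L : edges G -> set C) x y : adj x y ->
  exists e, edge_list L x y = L e.
Proof.
move=> xy; have exy : edges G [set x; y] by exists x, y.
exists (SigSub (mem_set exy)); apply/seteqP; split=> a /=.
  by move=> [e eE]; suff -> : SigSub (mem_set exy) = e by []; apply: val_inj; rewrite eE.
by exists (SigSub (mem_set exy)).
Qed.

(** Colourings are built on ordered pairs; symmetry of [col] makes the chosen order of the two ends
    of an edge harmless. *)
Lemma exists_colouring G (C : Type) (L : edges G -> set C) (col : G -> G -> C) :
  (forall x y, adj x y -> col x y = col y x) ->
  (forall x y, adj x y -> edge_list L x y (col x y)) ->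
  (forall f : G -> G, is_automorphism f ->
     (forall x y, adj x y -> col (f x) (f y) = col x y) -> f =1 id) ->
  exists c : edges G -> C, (forall e, L e (c e)) /\ distinguishing c.
Proof.
move=> colC colL col_rigid.
have endsP (e : edges G) : {xy : G * G | adj xy.1 xy.2 /\ val e = [set xy.1; xy.2]}.
  by apply: cid; have [x [y [xy exy]]] := set_valP e; exists (x, y).
pose c e := col (sval (endsP e)).1 (sval (endsP e)).2.
have cE e x y : adj x y -> val e = [set x; y] -> c e = col x y.
  move=> xy exy; rewrite /c; case: (endsP e) => -[a b] /= [_ eab].
  by have [[-> ->]|[-> ->]] := set2_eq (etrans (esym eab) exy); rewrite // (colC x y).
exists c; split=> [e|f f_aut f_col].
  have := endsP e; case=> -[x y] /= [xy exy]; rewrite (cE _ _ _ xy exy).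
  have [e' e'xy Le'] := colL _ _ xy.
  by have -> : e = e' by exact: val_inj (etrans exy (esym e'xy)).
apply: col_rigid => // x y xy.
have exy : edges G [set x; y] by exists x, y.
have efxy : edges G [set f x; f y] by exists (f x), (f y); rewrite f_aut.2.
pose e : edges G := SigSub (mem_set exy); pose e' : edges G := SigSub (mem_set efxy).
rewrite -(cE e x y xy erefl) -(cE e' (f x) (f y) _ erefl) ?f_aut.2//; apply: f_col => /=.
by rewrite image_setU !image_set1.
Qed.

(** By [bfs_par_eq] the parent depends only on the set of neighbours one level up, so it is
    respected by an automorphism that fixes all smaller levels. *)
Record bfs_tree (G : sgraph) (B : seq G) (lev : G -> nat) (par : G -> G) : Prop := {
  bfs_lev0 : forall x, (lev x == 0) = (x \in B);
  bfs_lev_adj : forall x y, adj x y -> lev y <= (lev x).+1;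
  bfs_par_adj : forall y, y \notin B -> adj (par y) y;
  bfs_par_lev : forall y, y \notin B -> lev y = (lev (par y)).+1;
  bfs_par_eq : forall y z, y \notin B -> z \notin B ->
    (forall x, adj x y && (lev x < lev y) = adj x z && (lev x < lev z)) ->
    par y = par z }.

Lemma exists_bfs_tree (G : sgraph) (B : seq G) :
  graph_connected G -> B != [::] -> exists lev par, bfs_tree B lev par.
Proof.
case: B => // b B' G_conn _; set B := b :: B'.
pose ball := fix ball n (x : G) : Prop :=
  if n is n'.+1 then ball n' x \/ exists2 y, ball n' y & adj y x else x \in B.
have ball_path p x n : ball n x -> path (@adj G) x p -> ball (n + size p) (last x p).
  elim: p x n => [|y p IH] x n nx /=; first by rewrite addn0.
  move=> /andP[xy]; rewrite -addSnnS; apply: IH; right; by exists x.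
have ex_ball x : exists n, `[< ball n x >].
  have [p bp ->] := G_conn b x; exists (0 + size p); apply/asboolP.
  by apply: ball_path => //=; rewrite mem_head.
pose lev x := ex_minn (ex_ball x).
have levP x : ball (lev x) x by rewrite /lev; case: ex_minnP => n /asboolP.
have lev_min x n : ball n x -> lev x <= n.
  by rewrite /lev; case: ex_minnP => m _ min /asboolP/min.
have lev0 x : (lev x == 0) = (x \in B).
  apply/eqP/idP => [l0|xB]; first by have := levP x; rewrite l0.
  by have := @lev_min x 0 xB; case: (lev x).
have lev_adj x y : adj x y -> lev y <= (lev x).+1.
  by move=> xy; apply: lev_min; right; exists x.
have up y : y \notin B -> exists2 x, adj x y & lev y = (lev x).+1.
  rewrite -lev0; have := levP y; case e: (lev y) => [|n] //= [ny|[x nx xy]] _.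
    by have := lev_min _ _ ny; rewrite e ltnn.
  exists x => //; apply/eqP; rewrite eqn_leq -{1}e lev_adj// ltnS; exact: lev_min.
pose U y : set {eclassic G} := [set x : G | adj x y /\ lev x < lev y].
(* [xget] sees only the set [U y], so equal sets of upper neighbours give equal parents. *)
pose par y : G := xget (b : {eclassic G}) (U y).
have parP y : y \notin B -> U y (par y).
  by move=> yB; apply: xgetPex; have [x xy lx] := up y yB; exists x; split; rewrite // lx.
exists lev, par; split=> //.
- by move=> y /parP[].
- by move=> y /parP[xy lx]; apply/eqP; rewrite eqn_leq lev_adj.
- move=> y z _ _ yz; rewrite /par; have -> // : U y = U z.
  by apply/seteqP; split=> x /andP h; apply/andP; [rewrite -yz|rewrite yz].
Qed.

Section BfsTree.
Variables (G : sgraph) (B : seq G) (lev : G -> nat) (par : G -> G).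
Hypothesis T : bfs_tree B lev par.

(** Induction on the level. If all smaller levels are fixed, then [f x] stays on the level of [x] by
    injectivity and has the same upper neighbours, hence the same parent; the parent is fixed, so
    the edges from it to [x] and to [f x] have one colour and [f x = x]. *)
Lemma bfs_rigid (C : Type) (col : G -> G -> C) (f : G -> G) :
  is_automorphism f -> (forall x y, adj x y -> col (f x) (f y) = col x y) ->
  (forall y z, y \notin B -> z \notin B -> par y = par z ->
     col (par y) y = col (par z) z -> y = z) ->
  {in B, f =1 id} -> f =1 id.
Proof.
move=> [f_bij f_adj] f_col col_inj fB.
suff fix_lev n x : lev x <= n -> f x = x by move=> x; exact: fix_lev (leqnn _).
elim: n x => [|n IH] x; first by rewrite leqn0 (bfs_lev0 T) => /fB.
rewrite leq_eqVlt => /orP[/eqP lx|]; last exact: IH.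
have xB : x \notin B by rewrite -(bfs_lev0 T) lx.
have px := bfs_par_adj T xB; have lpx := bfs_par_lev T xB.
have fpx : f (par x) = par x by apply: IH; rewrite -ltnS -lpx lx.
have lfx : lev (f x) = n.+1.
  apply/eqP; rewrite eqn_leq; apply/andP; split.
    by rewrite -lx lpx; apply: (bfs_lev_adj T); rewrite -fpx f_adj.
  rewrite ltnNge; apply/negP => /[dup] lfn /IH /(bij_inj f_bij) fxx.
  by move: lfn; rewrite fxx lx ltnn.
have fxB : f x \notin B by rewrite -(bfs_lev0 T) lfx.
have pfx : par (f x) = par x.
  apply: (bfs_par_eq T) => // z; rewrite lfx lx ltnS.
  by case: (leqP (lev z) n) => [/IH fz|]; rewrite ?andbF// -{1}fz f_adj.
apply: col_inj => //; rewrite pfx -[in LHS]fpx; exact: f_col.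
Qed.

(** [chi y] is the colour of the edge from [y] up to its parent; [cb] colours all edges outside the
    tree. *)
Definition tree_col (C : Type) (chi : G -> C) (cb : G -> G -> C) x y :=
  if (y \notin B) && (par y == x) then chi y
  else if (x \notin B) && (par x == y) then chi x else cb x y.

Variables (C : Type) (chi : G -> C) (cb : G -> G -> C).

Lemma bfs_par_asym x y : y \notin B -> par y = x -> x \notin B -> par x <> y.
Proof.
by move=> yB yx xB xy; have := bfs_par_lev T yB; rewrite yx (bfs_par_lev T xB) xy; lia.
Qed.

Lemma tree_colC : (forall x y, cb x y = cb y x) ->
  forall x y, tree_col chi cb x y = tree_col chi cb y x.
Proof.
move=> cbC x y; rewrite /tree_col.
case: ifP => [/andP[yB /eqP yx]|_]; last by case: ifP.
by case: ifP => // /andP[xB /eqP]; have /(_ _ _ yB yx xB) := bfs_par_asym.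
Qed.

Lemma tree_col_par y : y \notin B -> tree_col chi cb (par y) y = chi y.
Proof. by move=> yB; rewrite /tree_col yB eqxx. Qed.

Variant tree_col_spec x y : C -> Prop :=
  | TreeColDown of y \notin B & par y = x : tree_col_spec x y (chi y)
  | TreeColUp of x \notin B & par x = y : tree_col_spec x y (chi x)
  | TreeColBase of (y \in B) || (par y != x) & (x \in B) || (par x != y) :
      tree_col_spec x y (cb x y).

Lemma tree_colP x y : tree_col_spec x y (tree_col chi cb x y).
Proof.
rewrite /tree_col; case: ifP => [/andP[yB /eqP yx]|/negbT]; first by constructor.
rewrite negb_and negbK => h; case: ifP => [/andP[xB /eqP xy]|/negbT]; first by constructor.
by rewrite negb_and negbK; constructor.
Qed.

End BfsTree.

(** * Infinite maximum degree *)

Definition same_pair (T : eqType) (x y u v : T) :=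
  ((x == u) && (y == v)) || ((x == v) && (y == u)).

Lemma same_pairC (T : eqType) (x y u v : T) : same_pair x y u v = same_pair y x u v.
Proof. by rewrite /same_pair orbC andbC [X in _ || X]andbC. Qed.

(** Only the edge [r a] gets the colour [al] and only [r b] gets [be]. A colour-preserving
    automorphism keeps both edges, hence fixes their common end [r], and then [a] and [b]. *)
Lemma infinite_degree_distinguishing (G : sgraph) (D C : Type) (L : edges G -> set C) (r a b : G) :
  graph_connected G -> infinite_set [set: D] ->
  (forall x : G, neighbours x #<= [set: D]) -> (forall e, [set: D] #<= L e) ->
  adj r a -> adj r b -> a != b ->
  exists c : edges G -> C, (forall e, L e (c e)) /\ distinguishing c.
Proof.
move=> G_conn Doo degD LD ra rb ab.
pose l := edge_list L.
have lD x y : adj x y -> [set: D] #<= l x y.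
  by move=> /(edge_listE L)[e]; rewrite /l => ->.
have loo x y : adj x y -> infinite_set (l x y).
  by move=> /lD Dl fin; apply: Doo; exact: card_le_finite Dl fin.
have [al al_l] := infinite_setN0 (loo _ _ ra).
have [be [be_l bal]] := infinite_setN0 (infinite_setD (loo _ _ rb) (finite_set1 al)).
(* Deleting two colours from an infinite list does not lower its cardinality. *)
pose l' x y := l x y `\` [set al; be].
have l'D x y : adj x y -> [set: D] #<= l' x y.
  by move=> xy; apply: card_le_trans (lD _ _ xy) (card_le_infinite_setD2 _ _ (loo _ _ xy)).
pose B := [:: r; a; b].
have [lev [par T]] := @exists_bfs_tree G B G_conn isT.
(* The children of each [x] are coloured separately; [F (par y) y] later puts these choices
   together. *)
have chiP x : exists chi : G -> C, forall y, y \notin B -> par y = x ->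
    l' x y (chi y) /\ forall z, z \notin B -> par z = x -> chi y = chi z -> y = z.
  pose J := [set y | y \notin B /\ par y = x].
  have JD : [set: J] #<= [set: D].
    rewrite (card_le_eql (card_setT _)); apply: card_le_trans (degD x).
    by apply: subset_card_le => y [yB <-]; exact: bfs_par_adj T _ yB.
  have [|f [f_inj fl]] := @exists_injective_choice J C (fun y => l' x (val y)).
    move=> y; apply: card_le_trans JD (l'D _ _ _).
    by have [yB <-] := set_valP y; exact: bfs_par_adj T _ yB.
  pose chi y := if pselect (J y) is left Jy then f (SigSub (mem_set Jy)) else al.
  exists chi => y yB yx; have Jy : J y by [].
  rewrite /chi; case: pselect => // {}Jy; split; first exact: (fl (SigSub (mem_set Jy))).
  by move=> z zB zx; case: pselect => [Jz /f_inj[]|[]].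
have [F FP] := choice chiP.
pose chi y := F (par y) y.
pose lam x y : C := xget (al : {classic C}) (l' x y).
pose cb x y := if same_pair x y r a then al else if same_pair x y r b then be else lam x y.
have lamP x y : adj x y -> l' x y (lam x y).
  move=> xy; apply: (@xgetPex {classic C}); apply/set0P/eqP => l0.
  by have := l'D _ _ xy; rewrite l0 => /card_le_finite/(_ (finite_set0 _)).
have cbC x y : cb x y = cb y x.
  by rewrite /cb /lam /l' /l edge_listC !(same_pairC x y).
pose col := tree_col B par chi cb.
have chi_l y : y \notin B -> l' (par y) y (chi y) by move=> yB; case: (FP (par y) y yB erefl).
have colP x y : adj x y -> col x y = al /\ same_pair x y r a \/
    col x y = be /\ same_pair x y r b \/ l' x y (col x y).
  move=> xy; rewrite /col; case: tree_colP => [yB yx|xB yx|_ _].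
  - by right; right; rewrite -yx; exact: chi_l.
  - by right; right; rewrite -yx /l' /l edge_listC; exact: chi_l.
  - rewrite /cb; case: ifP => [h|_]; first by left.
    by case: ifP => [h|_]; [right; left | right; right; exact: lamP].
have rB : r \in B by rewrite !inE eqxx.
have aB : a \in B by rewrite !inE eqxx orbT.
have bB : b \in B by rewrite !inE eqxx !orbT.
have ral : col r a = al by rewrite /col /tree_col rB aB /= /cb /same_pair !eqxx.
have rbe : col r b = be.
  rewrite /col /tree_col rB bB /= /cb /same_pair !eqxx /= [b == a]eq_sym (negbTE ab).
  by case: (eqVneq r a) => // ra'; rewrite ra' adj_irr in ra.
apply: (@exists_colouring _ _ _ col (fun x y _ => tree_colC T _ cbC x y)) => [x y xy|f f_aut f_col].
  case: (colP _ _ xy) => [[-> /orP[]/andP[/eqP-> /eqP->]//]|].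
    by rewrite edge_listC.
  case=> [[-> /orP[]/andP[/eqP-> /eqP->]//]|[]//].
  by rewrite edge_listC.
have alE x y : adj x y -> col x y = al -> same_pair x y r a.
  by move=> xy e; case: (colP _ _ xy) => [[]//|[[]|[_]]]; rewrite e; [move/esym|case; left].
have beE x y : adj x y -> col x y = be -> same_pair x y r b.
  by move=> xy e; case: (colP _ _ xy) => [[]|[[]//|[_]]]; rewrite e => //; case; right.
have fra : same_pair (f r) (f a) r a by apply: alE; rewrite ?f_aut.2// f_col.
have frb : same_pair (f r) (f b) r b by apply: beE; rewrite ?f_aut.2// f_col.
apply: (bfs_rigid T f_aut f_col) => [y z yB zB yz|].
  rewrite /col !tree_col_par// => e.
  have [_] := FP (par y) y yB erefl; apply=> //; move: e; by rewrite /chi yz.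
have ar : a != r by apply/eqP => e; rewrite e adj_irr in ra.
have br : b != r by apply/eqP => e; rewrite e adj_irr in rb.
have fr : f r = r.
  move: fra frb => /orP[/andP[/eqP//]|/andP[/eqP-> _]] /orP[/andP[/eqP//]|/andP[/eqP e _]].
  by rewrite e eqxx in ab.
move: fra frb; rewrite /same_pair fr eqxx ![r == _]eq_sym (negbTE ar) (negbTE br) !orbF /=.
by move=> /eqP fa /eqP fb x; rewrite !inE => /or3P[]/eqP->.
Qed.


(** * Finite choices *)

Lemma seq_notin_exists (C : eqType) (s t : seq C) :
  uniq s -> size t < size s -> exists2 c, c \in s & c \notin t.
Proof.
move=> s_uniq lt_ts; apply: contrapT => nc.
have /(uniq_leq_size s_uniq) : {subset s <= t}.
  by move=> c cs; apply: contrapT => /negP ct; apply: nc; exists c.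
by rewrite leqNgt lt_ts.
Qed.

Lemma seq_injective_choice (I C : eqType) (c0 : C) (s : seq I) (S : I -> seq C) :
  uniq s -> {in s, forall i, uniq (S i) /\ size s <= size (S i)} ->
  exists f : I -> C, {in s, forall i, f i \in S i} /\ {in s &, injective f}.
Proof.
elim: s => [|i s IH] /=; first by exists (fun=> c0).
move=> /andP[is_ s_uniq] SP; have [|f [fS f_inj]] := IH s_uniq.
  move=> j js; have [|? /ltnW] := SP j; first by rewrite inE js orbT.
  by split.
have [i_uniq] := SP i (mem_head _ _); rewrite -(size_map f s).
move=> /(seq_notin_exists i_uniq)[c ci cs].
exists (fun j => if j == i then c else f j); split=> [j|j j'].
  by rewrite inE; case: eqVneq => [->|_] //=; exact: fS.
rewrite !inE; case: eqVneq => [->|_] /=; case: eqVneq => [->|_] //=.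
- by move=> _ js' e; rewrite e map_f in cs.
- by move=> js _ e; rewrite -e map_f in cs.
- exact: f_inj.
Qed.

(** Without their bad colours the lists keep at least [k - 1] colours, enough for up to [k - 1]
    indices. If there are [k] indices, [e] is served last, from its full list, and is the only one
    that may get its bad colour. *)
Lemma seq_injective_choice_avoiding (I C : eqType) (c0 : C) (k : nat) (s : seq I)
    (S : I -> seq C) (bad : I -> C) (e : I) :
  uniq s -> size s <= k -> {in s, forall i, uniq (S i) /\ k <= size (S i)} ->
  (size s = k -> e \in s) ->
  exists f : I -> C, [/\ {in s, forall i, f i \in S i}, {in s &, injective f} &
    {in s, forall i, f i = bad i -> size s = k /\ i = e}].
Proof.
move=> s_uniq s_le SP es; pose S' i := rem (bad i) (S i).
have S'P i : i \in s -> uniq (S' i) /\ k.-1 <= size (S' i).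
  move=> /SP[Si_uniq k_le]; split; first exact: rem_uniq.
  rewrite /S'; case: (boolP (bad i \in S i)) => h.
    by rewrite size_rem//; lia.
  by rewrite rem_id//; lia.
have S'S i c : i \in s -> c \in S' i -> c \in S i /\ c <> bad i.
  move=> /SP[Si_uniq _]; rewrite mem_rem_uniq// => /andP[/= /eqP]; by split.
have [s_lt|s_eq] := ltnP (size s) k.
  have [|f [fS f_inj]] := @seq_injective_choice I C c0 s S' s_uniq.
    by move=> i /S'P[? ?]; split=> //; lia.
  exists f; split=> // i is_; have := fS i is_; by case/(S'S _ _ is_).
have {s_le}s_eq : size s = k by lia.
have {}es := es s_eq; have s'_sub := mem_rem (x := e) (s := s).
have s'_size : size (rem e s) = k.-1 by rewrite size_rem// s_eq.
have [|f [fS f_inj]] := @seq_injective_choice I C c0 (rem e s) S' (rem_uniq e s_uniq).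
  by move=> i /s'_sub/S'P; rewrite s'_size.
have [e_uniq ke] := SP e es.
have [|c cS cf] := @seq_notin_exists C (S e) [seq f i | i <- rem e s] e_uniq.
  have : 0 < size s by case: (s) es.
  by rewrite size_map s'_size; lia.
have s'E i : i \in s -> i != e -> i \in rem e s by move=> ? ?; rewrite mem_rem_uniq// inE; apply/andP.
exists (fun i => if i == e then c else f i); split=> [i is_|i j is_ js|i is_].
- case: eqVneq => [->|ie] //; exact: (S'S _ _ is_ (fS _ (s'E _ is_ ie))).1.
- case: eqVneq => [->|ie]; case: eqVneq => [->|je] //.
  + by move=> h; rewrite h map_f ?s'E in cf.
  + by move=> h; rewrite -h map_f ?s'E in cf.
  + by apply: f_inj; exact: s'E.
- case: eqVneq => [->//|ie] h.
  by have [_] := S'S _ _ is_ (fS _ (s'E _ is_ ie)).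
Qed.

(** [s] is built lexicographically: each coordinate is the least one among the members of [S] that
    agree with the earlier coordinates. *)
Lemma exists_minimal_seq (C : Type) (W : C -> C -> Prop)
    (W_anti : forall x y, W x y -> W y x -> x = y)
    (W_min : forall A : set C, A !=set0 -> exists2 z, A z & forall x, A x -> W z x)
    (n : nat) (S : set (nat -> C)) : S !=set0 ->
  exists2 s, S s & forall t, S t -> (forall i, i < n -> W (t i) (s i)) ->
    forall i, i < n -> t i = s i.
Proof.
move=> [s0 Ss0]; elim: n => [|n [s Ss s_min]]; first by exists s0.
have [|c [s' [Ss' s's] <-] c_min] :=
    W_min [set c | exists2 t, S t /\ (forall i, i < n -> t i = s i) & t n = c].
  by exists (s n), s.
exists s' => // t St ts'; have ts i : i < n -> t i = s i.
  by apply: s_min => // j jn; rewrite -s's//; apply: ts'; exact: leqW.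
move=> i; rewrite ltnS leq_eqVlt => /orP[/eqP->|lt_in].
  apply: W_anti; first exact: ts'.
  by apply: c_min; exists t.
by rewrite s's// ts.
Qed.


(** * Key-minimal patterns *)

(** A cycle [b 1, ..., b g] with the pendant edge [b 0 b 1]; [k] is the size of the lists. The last
    clause excludes the chord from [b 0] to [b g.-1] when [k = 2], since two colours cannot avoid
    both a key and the colour of the closing edge. *)
Definition pattern (G : sgraph) (k g : nat) (b : nat -> G) : Prop :=
  [/\ forall i j, i <= g -> j <= g -> b i = b j -> i = j,
      forall i, i < g -> adj (b i) (b i.+1),
      adj (b 1) (b g), 3 <= g & (3 <= k) || ~~ adj (b 0) (b g.-1)].

Lemma pattern_aut (G : sgraph) k g (b : nat -> G) f :
  is_automorphism f -> pattern k g b -> pattern k g (f \o b).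
Proof.
move=> [f_bij f_adj] [b_inj b_adj b1g g3 bk]; split=> //=; rewrite ?f_adj//.
- by move=> i j ig jg /(bij_inj f_bij); exact: b_inj.
- by move=> i ig; rewrite f_adj b_adj.
Qed.

Section PatternColouring.
Variables (G : sgraph) (C : eqType) (k g : nat) (b : nat -> G).
Variables (l : G -> G -> seq C) (kap : seq C -> C) (N : G -> seq G).
Variables (lev : G -> nat) (par : G -> G).
Hypothesis k_ge2 : 2 <= k.
Hypothesis b_pat : pattern k g b.
Hypothesis lC : forall x y, l x y = l y x.
Hypothesis l_uniq : forall x y, adj x y -> uniq (l x y).
Hypothesis l_size : forall x y, adj x y -> k <= size (l x y).
Hypothesis kapP : forall s, s != [::] -> kap s \in s.
Hypothesis N_uniq : forall x, uniq (N x).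
Hypothesis NP : forall x y, (y \in N x) = adj x y.
Hypothesis N_size : forall x, size (N x) <= k.+1.
Let B := mkseq b g.+1.
Hypothesis T : bfs_tree B lev par.

Let b_inj i j : i <= g -> j <= g -> b i = b j -> i = j.
Proof. by case: b_pat => h _ _ _ _; exact: h. Qed.
Let b_adj i : i < g -> adj (b i) (b i.+1).
Proof. by case: b_pat => _ h _ _ _; exact: h. Qed.
Let b1g : adj (b 1) (b g). Proof. by case: b_pat. Qed.
Let g_ge3 : 3 <= g. Proof. by case: b_pat. Qed.

Let b_neq i j : i <= g -> j <= g -> i != j -> b i != b j.
Proof. by move=> ig jg; apply: contraNneq => /b_inj -> //. Qed.

Let bB i : i <= g -> b i \in B.
Proof. by move=> ig; apply: map_f; rewrite mem_iota. Qed.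

Let BP x : x \in B -> exists2 i, i <= g & x = b i.
Proof. by case/mapP=> i; rewrite mem_iota => ig ->; exists i. Qed.

Let children x := [seq y <- N x | (y \notin B) && (par y == x)].

Let childrenP x y : y \in children x -> [/\ y \notin B, par y = x & adj x y].
Proof. by rewrite mem_filter NP => /andP[/andP[yB /eqP yx] xy]. Qed.

Let mem_children y : y \notin B -> y \in children (par y).
Proof. by move=> yB; rewrite mem_filter yB eqxx NP /=; exact: bfs_par_adj T _ yB. Qed.

Let children_uniq x : uniq (children x).
Proof. exact: filter_uniq. Qed.

Let nbr_bound (v : G) (s : seq G) : uniq s -> {in s, forall z, adj v z} -> size s <= k.+1.
Proof.
move=> s_uniq sv; apply: leq_trans (N_size v); apply: uniq_leq_size => // z /sv.
by rewrite NP.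
Qed.

(** This is the largest possible number of children, since degrees are at most [k + 1] and every
    vertex has a neighbour that is not a child. *)
Let full x := size (children x) == k.

Let full_nbr x u z : full x -> adj x u -> u \notin children x ->
  adj x z -> z \notin children x -> z = u.
Proof.
move=> /eqP xf xu uc xz zc; apply: contrapT => /eqP zu.
have : size (z :: u :: children x) <= k.+1; last by rewrite /= xf ltnn.
apply: (@nbr_bound x); first by rewrite /= inE negb_or zu zc uc children_uniq.
by move=> t; rewrite !inE => /or3P[/eqP->|/eqP->|/childrenP[]].
Qed.

Let base_not_child x i : i <= g -> b i \notin children x.
Proof. by move=> ig; rewrite mem_filter bB. Qed.

(** Such a vertex has two neighbours in [B]: its predecessor, and its successor or, for [i = g], the
    vertex [b 1]. *)
Let not_full_base i : 0 < i -> i <= g -> ~~ full (b i).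
Proof.
move=> i0 ig; apply/negP => fi.
have adj_pred : adj (b i) (b i.-1) by rewrite adj_sym -{2}(prednK i0) b_adj ?prednK.
have [j [jg jN ji]] : exists j, [/\ j <= g, j != i.-1 & adj (b i) (b j)].
  move: ig; rewrite leq_eqVlt => /orP[/eqP->|ig]; last by exists i.+1; split; rewrite ?b_adj//; lia.
  by exists 1; split; rewrite ?[adj (b g) _]adj_sym//; lia.
have /b_inj jE : b j = b i.-1 by apply: full_nbr fi adj_pred _ ji _; rewrite base_not_child//; lia.
by move/eqP: jN; apply; apply: jE; lia.
Qed.

Let children_size x : (exists2 u, adj x u & u \notin children x) -> size (children x) <= k.
Proof.
move=> [u xu uc]; rewrite -ltnS; apply: (@nbr_bound x (u :: children x)) => /=.
  by rewrite uc children_uniq.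
by move=> z; rewrite inE => /orP[/eqP->|/childrenP[]].
Qed.

Let outsider x : exists2 u, adj x u & u \notin children x.
Proof.
have [/BP[i ig ->]|xB] := boolP (x \in B).
  move: ig; rewrite leq_eqVlt => /orP[/eqP->|ig].
    by exists (b 1); rewrite 1?adj_sym// base_not_child//; lia.
  by exists (b i.+1); rewrite ?b_adj// base_not_child.
exists (par x); first by rewrite adj_sym (bfs_par_adj T).
by apply/negP => /childrenP[pB pp _]; exact: (bfs_par_asym T xB erefl pB pp).
Qed.

(* In a full vertex, one child edge may have to take its smallest colour; the
   child is chosen so that the path of such edges descending from [b 0] never
   closes up to a copy of the pattern. *)
Let target x := b (g - 3 - lev x).+1.

Let excP x : exists y, full x -> y \in children x /\ ~~ adj y (target x).
Proof.
have [fx|] := boolP (full x); last by exists x.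
suff [y yx yt] : exists2 y, y \in children x & ~~ adj y (target x) by exists y.
apply: contrapT => ny; set j := g - 3 - lev x.
have jg : j.+2 <= g by rewrite /j; lia.
(* [target x] is an inner vertex of the path; its two path neighbours and [k] adjacent children
   would exceed the degree bound. *)
have : size (b j :: b j.+2 :: children x) <= k.+1; last by rewrite /= (eqP fx) ltnn.
apply: (@nbr_bound (target x)) => [|z].
  by rewrite /= inE (negbTE (b_neq _ jg _)) ?base_not_child ?children_uniq//; lia.
rewrite !inE => /or3P[/eqP->|/eqP->|zx].
- by rewrite adj_sym b_adj//; lia.
- by rewrite b_adj//; lia.
- rewrite adj_sym; apply: contrapT => /negP zt; apply: ny; by exists z.
Qed.

Let exc x := sval (cid (excP x)).
Let exc_spec x : full x -> exc x \in children x /\ ~~ adj (exc x) (target x).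
Proof. exact: svalP (cid (excP x)). Qed.

Let kp x y := kap (l x y).
Let kpC x y : kp x y = kp y x. Proof. by rewrite /kp lC. Qed.
Let l_neq0 x y : adj x y -> l x y != [::].
Proof. by move=> /l_size; case: (l x y) => //=; lia. Qed.

Let c0 : C := kp (b 0) (b 1).

Let chiP x : exists chi : G -> C, [/\ {in children x, forall y, chi y \in l x y},
  {in children x &, injective chi} &
  {in children x, forall y, chi y = kp x y -> full x /\ y = exc x}].
Proof.
have [||i /childrenP[_ _ xi]||chi [? ? h]] := @seq_injective_choice_avoiding G C c0 k
    (children x) (l x) (kp x) (exc x).
- exact: children_uniq.
- exact/children_size/outsider.
- by split; [exact: l_uniq | exact: l_size].
- by move=> /eqP fx; case: (exc_spec fx).
by exists chi; split=> // y yx /(h y yx)[/eqP].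
Qed.

Let F x := sval (cid (chiP x)).
Let chi y := F (par y) y.

Let chi_l y : y \notin B -> chi y \in l (par y) y.
Proof. by move=> yB; rewrite /chi /F; case: cid => f [/= fl _ _]; exact/fl/mem_children. Qed.

Let chi_inj y z : y \notin B -> z \notin B -> par y = par z -> chi y = chi z -> y = z.
Proof.
move=> yB zB yz; rewrite /chi yz /F; case: cid => f [/= _ f_inj _]; apply: f_inj.
  by rewrite -yz mem_children.
exact: mem_children.
Qed.

Let chi_kp y : y \notin B -> chi y = kp (par y) y -> full (par y) /\ y = exc (par y).
Proof.
by move=> yB; rewrite /chi /F; case: cid => f [/= _ _ fk]; exact/fk/mem_children.
Qed.

Let lam0 x y := head c0 [seq c <- l x y | c != kp x y].
Let lam1 x y := head c0 [seq c <- l x y | (c != kp x y) && (c != lam0 (b 1) (b g))].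
Let on_path x y := has (fun i => same_pair x y (b i) (b i.+1)) (iota 0 g).
Let cb x y := if on_path x y then kp x y
  else if same_pair x y (b 0) (b g.-1) then lam1 x y else lam0 x y.

Let on_pathC x y : on_path x y = on_path y x.
Proof. by apply: eq_has => i; rewrite same_pairC. Qed.

Let cbC x y : cb x y = cb y x.
Proof. by rewrite /cb on_pathC same_pairC /lam1 /lam0 (lC x y) (kpC x y). Qed.

Let head_filter (s : seq C) (p : pred C) : (exists2 c, c \in s & p c) ->
  head c0 (filter p s) \in s /\ p (head c0 (filter p s)).
Proof.
move=> [c cs pc]; have : c \in filter p s by rewrite mem_filter pc.
case e: (filter p s) => [|d t] //= _.
by have : d \in filter p s by [rewrite e mem_head]; rewrite mem_filter => /andP[].
Qed.

Let lam0P x y : adj x y -> lam0 x y \in l x y /\ lam0 x y != kp x y.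
Proof.
move=> xy; apply: (@head_filter _ (fun c => c != kp x y)).
have [|c cl] := @seq_notin_exists _ _ [:: kp x y] (l_uniq xy).
  by have := l_size xy; rewrite /=; lia.
by rewrite inE; exists c.
Qed.

Let lam1P x y : adj x y -> 3 <= k ->
  lam1 x y \in l x y /\ (lam1 x y != kp x y) && (lam1 x y != lam0 (b 1) (b g)).
Proof.
move=> xy k3; apply: (@head_filter _ (fun c => (c != kp x y) && (c != lam0 (b 1) (b g)))).
have [|c cl] := @seq_notin_exists _ _ [:: kp x y; lam0 (b 1) (b g)] (l_uniq xy).
  by have := l_size xy; rewrite /=; lia.
by rewrite !inE negb_or; exists c.
Qed.

Let last_chord x y : adj x y -> same_pair x y (b 0) (b g.-1) -> 3 <= k.
Proof.
have [_ _ _ _ /orP[//|/negP nadj]] := b_pat => xy /orP[]/andP[/eqP e /eqP e'].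
  by case: nadj; rewrite -e -e'.
by case: nadj; rewrite -e -e' adj_sym.
Qed.

Let col := tree_col B par chi cb.

Let col_l x y : adj x y -> col x y \in l x y.
Proof.
move=> xy; rewrite /col; case: tree_colP => [yB <-|xB <-|_ _]; first exact: chi_l.
  by rewrite lC chi_l.
rewrite /cb; case: ifP => _; first by apply: kapP; exact: l_neq0.
by case: ifP => [/(last_chord xy) k3|_]; [have [] := lam1P xy k3 | have [] := lam0P xy].
Qed.

(** An orientation of the edges that may carry their key: along the path from [b g] down to [b 0],
    and from a full vertex to its exceptional child. *)
Let step x y := (exists2 i, i < g & x = b i.+1 /\ y = b i) \/
  [/\ y \notin B, par y = x, full x & y = exc x].

Let col_step x y : adj x y -> col x y = kp x y -> step x y \/ step y x.
Proof.
move=> xy; rewrite /col; case: tree_colP => [yB yx|xB yx|_ _].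
- by rewrite -yx => /(chi_kp yB)[fx ex]; left; right; split.
- by rewrite kpC -yx => /(chi_kp xB)[fx ex]; right; right; split.
- rewrite /cb; case: ifP => [/hasP[i]|_].
    rewrite mem_iota => /andP[_ ig] /orP[]/andP[/eqP-> /eqP->] _; last by left; left; exists i.
    by right; left; exists i.
  case: ifP => [/(last_chord xy) k3|_] e.
    by have [_] := lam1P xy k3; rewrite e eqxx.
  by have [_] := lam0P xy; rewrite e eqxx.
Qed.

(** Steps do not branch: the vertices [b i] with [i > 0] are not full, so the two kinds of step
    never leave the same vertex. *)
Let step_fun x y z : step x y -> step x z -> y = z.
Proof.
case=> [[i ig [-> ->]]|[yB yx fx ->]] [[j jg [xj ->]]|[zB zx fx' ->]] //.
- by have [->] := b_inj ig jg xj.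
- by rewrite (negbTE (not_full_base _ _)) in fx'.
- by move: fx; rewrite xj (negbTE (not_full_base _ _)).
Qed.

(** Steps do not merge: those of the first kind end in [B], those of the second kind outside [B]. *)
Let step_inj x y z : step x z -> step y z -> x = y.
Proof.
case=> [[i ig [-> zi]]|[zB <- _ _]] [[j jg [-> zj]]|[zB' <- _ _]] //.
- have e : b i = b j by rewrite -zi.
  by rewrite (b_inj _ _ e)//; exact: ltnW.
- by rewrite zi bB// ltnW in zB'.
- by rewrite zj bB// ltnW in zB.
Qed.

(** A depth that each step raises by exactly one: [g - i] at [b i], and [g + lev x] outside [B]. *)
Let h x := if x \in B then g - index x B else g + lev x.

Let h_base i : i <= g -> h (b i) = g - i.
Proof.
move=> ig; rewrite /h bB//; congr (_ - _).
rewrite -[X in index X](nth_mkseq (b 0) b (n := g.+1))// index_uniq ?size_mkseq//.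
by apply/mkseq_uniqP => j j'; rewrite !inE !ltnS; exact: b_inj.
Qed.

Let h_out x : x \notin B -> h x = g + lev x.
Proof. by rewrite /h => /negbTE->. Qed.

Let h_le x : x \in B -> h x <= g. Proof. by rewrite /h => ->; lia. Qed.

Let lev_out x : x \notin B -> 0 < lev x.
Proof. by rewrite -(bfs_lev0 T) lt0n. Qed.

Let full_root x : full x -> x = b 0 \/ x \notin B.
Proof.
move=> fx; have [/BP[[|i] ig xi]|] := boolP (x \in B); [by left | | by right].
by move: fx; rewrite xi (negbTE (not_full_base _ _)).
Qed.

Let h_full x : full x -> h x = g + lev x.
Proof.
move=> /full_root[->|/h_out//]; rewrite h_base//.
have /eqP -> : lev (b 0) == 0 by rewrite (bfs_lev0 T) bB.
by rewrite subn0 addn0.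
Qed.

Let h_step x y : step x y -> h y = (h x).+1.
Proof.
case=> [[i ig [-> ->]]|[yB yx fx _]]; first by rewrite !h_base//; lia.
by rewrite h_out// h_full// (bfs_par_lev T yB) yx addnS.
Qed.

(** The one neighbour of a full vertex that is not its child: the parent, or [b 1] in the case of
    [b 0]. *)
Let full_parent x : full x -> exists u, [/\ adj x u, u \notin children x, h u <= h x &
  (x \notin B -> u = par x) /\ (x = b 0 -> u = b 1)].
Proof.
move=> fx; case: (full_root fx) => [xb|xB].
  exists (b 1); split; rewrite ?xb ?b_adj ?base_not_child ?h_base//; try lia.
  by split=> //; rewrite bB.
have [u xu uc] := outsider x; have pu : par x = u.
  have xp : adj x (par x) by rewrite adj_sym (bfs_par_adj T).
  apply: full_nbr fx xu uc xp _.
  by apply/negP => /childrenP[pB pp _]; exact: (bfs_par_asym T xB erefl pB pp).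
exists u; split=> //; last by split=> // xb; move: xB; rewrite xb bB.
rewrite -pu (h_out xB) (bfs_par_lev T xB); have [/h_le|/h_out->] := boolP (par x \in B); lia.
Qed.

(** This keeps the closing edge of a pattern, whose ends differ by [g - 1 >= 2] in [h] when the
    pattern runs along steps, from going deeper at a full vertex. *)
Let full_h_le x z : full x -> adj x z -> h z <= (h x).+1.
Proof.
move=> fx xz; have [zx|zx] := boolP (z \in children x).
  have [zB zp _] := childrenP zx.
  by rewrite h_out// h_full// (bfs_par_lev T zB) zp addnS.
have [u [xu ux hu _]] := full_parent fx.
by rewrite (full_nbr fx xu ux xz zx); exact: leqW.
Qed.

(** A change of direction would make [y i] and [y i.+2] equal, because steps neither merge nor
    branch. *)
Let monotone (y : nat -> G) : (forall i j, i <= g -> j <= g -> y i = y j -> i = j) ->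
  (forall i, i < g -> step (y i) (y i.+1) \/ step (y i.+1) (y i)) ->
  (forall i, i < g -> step (y i) (y i.+1)) \/ (forall i, i < g -> step (y i.+1) (y i)).
Proof.
move=> y_inj y_step; have [] := y_step 0; first lia.
  move=> s0; left; elim=> [//|i IH] ig; have si := IH (ltnW ig).
  case: (y_step _ ig) => // /(step_inj si) e.
  by have : i = i.+2 by [apply: y_inj e; lia]; lia.
move=> s0; right; elim=> [//|i IH] ig; have si := IH (ltnW ig).
case: (y_step _ ig) => // /(step_fun si) e.
by have : i = i.+2 by [apply: y_inj e; lia]; lia.
Qed.

Let col_b1g : col (b 1) (b g) = lam0 (b 1) (b g).
Proof.
rewrite /col /tree_col !bB//=; [|lia]; rewrite /cb ifF; last first.
  apply/negbTE/hasPn => i; rewrite mem_iota => /andP[_ ig].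
  by rewrite /same_pair; apply/negP => /orP[]/andP[/eqP/b_inj e /eqP/b_inj e']; lia.
rewrite ifF//; apply/negbTE/negP => /orP[]/andP[/eqP/b_inj e /eqP/b_inj e']; lia.
Qed.

Let col_chord : adj (b g.-1) (b 0) -> col (b g.-1) (b 0) != lam0 (b 1) (b g).
Proof.
move=> badj; have sp : same_pair (b g.-1) (b 0) (b 0) (b g.-1) by rewrite /same_pair !eqxx orbT.
have [_ /andP[_]] := lam1P badj (last_chord badj sp).
rewrite /col /tree_col !bB//=; [|lia]; rewrite /cb ifF ?sp//.
apply/negbTE/hasPn => i; rewrite mem_iota => /andP[_ ig].
by rewrite /same_pair; apply/negP => /orP[]/andP[/eqP/b_inj e /eqP/b_inj e']; lia.
Qed.

(** All edges of the path [y] are steps in one direction, so [h] changes by [g - 1] from [y 1] to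
    [y g]; the closing edge then leaves [y = b] as the only possibility. *)
Let pattern_fixed (y : nat -> G) : pattern k g y ->
  (forall i, i < g -> col (y i) (y i.+1) = kp (y i) (y i.+1)) ->
  col (y 1) (y g) = col (b 1) (b g) -> forall i, i <= g -> y i = b i.
Proof.
move=> [y_inj y_adj y1g _ _] y_kp y_col; have gE : g.-1.+1 = g by lia.
have [|down|up] := @monotone y y_inj.
- by move=> i ig; apply: col_step; [exact: y_adj | exact: y_kp].
(* First direction: the steps lead from [y 0] to [y g]. *)
- exfalso; have hy i : i <= g -> h (y i) = h (y 0) + i.
    elim: i => [|i IH] ig; first by rewrite addn0.
    by rewrite (h_step (down _ ig)) IH ?addnS// ltnW.
  have hyg : h (y g) = h (y 1) + g.-1 by rewrite (hy g)// (hy 1); lia.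
  (* [y 1] cannot be full, as the closing edge gains too much depth; so [y 1] lies on [b], and so
     does [y 0]. *)
  have [[j jg [y1 _]]|[_ _ f1 _]] := down 1 ltac:(lia); last first.
    by have := full_h_le f1 y1g; lia.
  have [[j' jg' [y0 y1']]|[yB _ _ _]] := down 0 ltac:(lia); last by rewrite y1 bB in yB.
  have jj' : j.+1 = j' by apply: b_inj; rewrite -?y1 -?y1'//; lia.
  move: hyg; rewrite y1 h_base// => hyg.
  move: (down g.-1 ltac:(lia)); rewrite gE => -[[i ig [_ yg]]|[yB yp fp ye]].
    (* Comparing depths, [y] is [b] reversed. Its closing edge is the chord from [b g.-1] to [b 0],
       which [lam1] colours unlike the closing edge of [b]. *)
    move: hyg; rewrite yg h_base; last lia; move=> hyg.
    have [i0 jE] : i = 0 /\ j = g.-2 by lia.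
    have y1E : y 1 = b g.-1 by rewrite y1 jE; congr b; lia.
    have ygE : y g = b 0 by rewrite yg i0.
    by have := col_chord; rewrite -y1E -ygE y_col col_b1g eqxx => /(_ y1g).
  (* Comparing depths, [y 1] is the target of [y g.-1], and the exceptional child [y g] was chosen
     not adjacent to it. *)
  have [_] := exc_spec fp; rewrite -ye /target.
  have -> : (g - 3 - lev (y g.-1)).+1 = j.+1.
    by move: hyg; rewrite h_out// (bfs_par_lev T yB) yp; lia.
  by rewrite -y1 adj_sym y1g.
(* Second direction: the steps lead from [y g] to [y 0], and [y g] lies on [b] because it cannot be
   full. *)
have hy i : i <= g -> h (y (g - i)) = h (y g) + i.
  elim: i => [|i IH] ig; first by rewrite subn0 addn0.
  have := up (g - i.+1) ltac:(lia).
  have -> : (g - i.+1).+1 = g - i by lia.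
  by move=> /h_step->; rewrite IH ?addnS// ltnW.
have hy1 : h (y 1) = h (y g) + g.-1 by rewrite -hy; [congr (h (y _)); lia | lia].
move: (up g.-1 ltac:(lia)); rewrite gE => -[[j jg [yg _]]|[_ _ fg _]]; last first.
  by have := @full_h_le _ (y 1) fg; rewrite adj_sym => /(_ y1g); lia.
(* If [y g = b g], following the unique steps from there recovers [b]. *)
have [jE|jN] := eqVneq j.+1 g.
  have fixed i : i <= g -> y (g - i) = b (g - i).
    elim: i => [|i IH] ig; first by rewrite subn0 yg jE.
    have := up (g - i.+1) ltac:(lia).
    have -> : (g - i.+1).+1 = g - i by lia.
    rewrite IH; last lia; move=> /step_fun; apply; left.
    by exists (g - i.+1); [lia | split=> //; congr b; lia].
  by move=> i ig; rewrite -(subKn ig) fixed//; lia.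
(* Otherwise depth forces [y 1] to be full, and [y g], not being its child, is its one other
   neighbour: [b 1], against the depth, or the parent [y 2], against injectivity. *)
exfalso; move: hy1; rewrite yg h_base// => hy1.
have [[i ig [y1 _]]|[_ _ f1 _]] := up 0 ltac:(lia).
  by move: hy1; rewrite y1 h_base; lia.
have [u [y1u uc hu [uout ub0]]] := full_parent f1.
have ygu : y g = u.
  by apply: full_nbr f1 y1u uc y1g _; rewrite yg base_not_child.
case: (full_root f1) => [y1b|y1B].
  move: ygu; rewrite (ub0 y1b) yg => /b_inj j1.
  by move: hy1; rewrite y1b h_base//; lia.
have [[i ig [_ y1i]]|[_ y2 _ _]] := up 1 ltac:(lia); first by rewrite y1i bB// ltnW in y1B.
have : y g = y 2 by rewrite ygu uout.
by move/y_inj; lia.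
Qed.

(** The edges of the image of [b] carry the keys of [b], which belong to their lists, so their own
    keys are not larger. Minimality gives equality, [pattern_fixed] shows that [B] is fixed, and
    [bfs_rigid] applies. *)
Lemma pattern_colouring (W : C -> C -> Prop) :
  (forall s c, c \in s -> W (kap s) c) ->
  (forall b', pattern k g b' ->
     (forall i, i < g -> W (kap (l (b' i) (b' i.+1))) (kap (l (b i) (b i.+1)))) ->
     forall i, i < g -> kap (l (b' i) (b' i.+1)) = kap (l (b i) (b i.+1))) ->
  exists c : G -> G -> C, [/\ forall x y, c x y = c y x,
    forall x y, adj x y -> c x y \in l x y &
    forall f, is_automorphism f -> (forall x y, adj x y -> c (f x) (f y) = c x y) -> f =1 id].
Proof.
move=> W_kap b_min; exists col; split=> [||f f_aut f_col]; [exact: (tree_colC T _ cbC)|exact: col_l|].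
have fb_pat := pattern_aut f_aut b_pat.
have col_b i : i < g -> col (b i) (b i.+1) = kp (b i) (b i.+1).
  move=> ig; rewrite /col /tree_col !bB//=; [|lia]; rewrite /cb ifT//.
  by apply/hasP; exists i; rewrite ?mem_iota// /same_pair !eqxx.
have fcol_b i : i < g -> col (f (b i)) (f (b i.+1)) = kp (b i) (b i.+1).
  by move=> ig; rewrite f_col ?b_adj// col_b.
have fb_kp i : i < g -> kp (f (b i)) (f (b i.+1)) = kp (b i) (b i.+1).
  apply: (b_min (f \o b)) => // j jg /=; rewrite -/(kp _ _) -/(kp (b j) _) -fcol_b//.
  by apply: W_kap; apply: col_l; rewrite f_aut.2 b_adj.
apply: (bfs_rigid T f_aut f_col) => [y z yB zB yz|x /BP[i ig ->]].
  by rewrite /col !tree_col_par//; exact: chi_inj.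
apply: (@pattern_fixed (f \o b)) => //= [j jg|]; first by rewrite fcol_b// fb_kp.
exact: f_col.
Qed.

End PatternColouring.


(** * Finite lists and the choice of a minimal pattern *)

Lemma card_eq_seq (T : eqType) (A : set T) n : A #= `I_n ->
  exists s : seq T, [/\ uniq s, size s = n & forall x, x \in s <-> A x].
Proof.
elim: n A => [|n IH] A.
  rewrite II0 card_eq0 => /eqP->; exists [::]; by split.
move=> /eq_cardSP[x Ax /IH[s [s_uniq s_size sA]]]; exists (x :: s); split=> /=.
- by rewrite s_uniq andbT; apply/negP => /sA[_]; exact.
- by rewrite s_size.
- move=> y; rewrite inE; split=> [/orP[/eqP->//|/sA[]//]|Ay].
  by case: eqVneq => //= /eqP yx; apply/sA.
Qed.

Lemma exists_neighbour_seq (G : sgraph) n : (forall x : G, neighbours x #<= `I_n) ->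
  exists N : G -> seq G, [/\ forall x, uniq (N x), forall x y, (y \in N x) = adj x y
    & forall x, size (N x) <= n].
Proof.
move=> degn; have NP x : exists s : seq G, [/\ uniq s, forall y, (y \in s) = adj x y & size s <= n].
  have : finite_set (neighbours x) by apply/finite_set_leP; exists n.
  move=> /finite_setP[m Am]; have [s [s_uniq s_size sA]] := card_eq_seq Am.
  exists s; split=> // [y|]; first by apply/idP/idP => /sA.
  by have := degn x; rewrite (card_le_eql Am) card_le_II s_size.
have [N {}NP] := choice NP.
by exists N; split=> x; have [] := NP x.
Qed.

(** One sequence is chosen for each set of colours, so [l] inherits the symmetry of [edge_list]. *)
Lemma exists_edge_seq (G : sgraph) (C : Type) (L : edges G -> set C) k :
  (forall e, L e #= `I_k) -> exists l : G -> G -> seq {classic C},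
  (forall x y, l x y = l y x) /\
  (forall x y, adj x y -> [/\ uniq (l x y), size (l x y) = k &
     forall c, c \in l x y -> edge_list L x y c]).
Proof.
move=> Lk; pose P (A : set {classic C}) (s : seq {classic C}) :=
  A #= `I_k -> [/\ uniq s, size s = k & forall c, c \in s -> A c].
have PP A : exists s, P A s.
  have [/card_eq_seq[s [? ? h]]|nA] := pselect (A #= `I_k).
    by exists s; split=> // c /h.
  by exists [::].
have [F FP] := choice PP; exists (fun x y => F (edge_list L x y)).
split=> [x y|x y xy]; first by rewrite edge_listC.
by apply: FP; have [e ->] := edge_listE L xy.
Qed.

Lemma pattern_distinguishing (G : sgraph) (C : Type) (L : edges G -> set C)
    (k g : nat) (b0 : nat -> G) :
  graph_connected G -> (forall x : G, neighbours x #<= `I_k.+1) -> 2 <= k ->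
  (forall e, L e #= `I_k) -> pattern k g b0 ->
  exists c : edges G -> C, (forall e, L e (c e)) /\ distinguishing c.
Proof.
move=> G_conn degk k2 Lk b0_pat.
have [N [N_uniq NP N_size]] := exists_neighbour_seq degk.
have [l [lC lP]] := exists_edge_seq Lk.
have [W [W_anti W_min]] := exists_well_order {classic C}.
(* A default colour, the key of the empty sequence. *)
have [c0 _] : exists c : {classic C}, True.
  have [_ _ /lP[_]] := b0_pat; case: (l _ _) => [|c ? _ _ _ _]; last by exists c.
  by move=> /= ke; rewrite -ke in k2.
have kapP (s : seq {classic C}) : exists c, s != [::] -> c \in s /\ forall d, d \in s -> W c d.
  case: s => [|c s]; first by exists c0.
  have [|d ds d_min] := W_min [set d | d \in c :: s]; first by exists c; exact: mem_head.
  by exists d.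
have [kap {}kapP] := choice kapP.
(* Only patterns of the same length [g] are compared, as automorphisms preserve it. *)
have [s [b [b_pat bs]] s_min] := @exists_minimal_seq _ W W_anti W_min g
  [set s | exists b, pattern k g b /\ s = fun i => kap (l (b i) (b i.+1))]
  (ex_intro _ _ (ex_intro _ b0 (conj b0_pat erefl))).
have [lev [par T]] := @exists_bfs_tree G (mkseq b g.+1) G_conn isT.
have [|||||c [cC cl c_rigid]] := @pattern_colouring G {classic C} k g b l kap N lev par
  k2 b_pat lC _ _ _ N_uniq NP N_size T W.
- by move=> x y /lP[].
- by move=> x y /lP[_ ->].
- by move=> t /kapP[].
- by move=> t c ct; have [|_] := kapP t; [case: t ct | apply].
- move=> b' b'_pat b'W; have := s_min (fun i => kap (l (b' i) (b' i.+1))).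
  by rewrite bs; apply=> //; exists b'.
apply: (@exists_colouring G C L c (fun x y _ => cC x y)) => // x y xy.
by have [_ _] := lP _ _ xy; apply; exact: cl.
Qed.

(** * Existence of patterns *)

Lemma pattern_of_seq (G : sgraph) k (w v : G) (q : seq G) : 3 <= k ->
  uniq (w :: v :: q) -> path (@adj G) w (v :: q) -> adj v (last v q) -> 2 <= size q ->
  pattern k (size q).+1 (nth w (w :: v :: q)).
Proof.
move=> k3 s_uniq s_path v_last q2; split; rewrite ?k3//.
- by move=> i j ig jg /eqP; rewrite nth_uniq// => /eqP.
- by move=> i ig; have /(pathP w) := s_path; apply.
- by rewrite /= -last_nth.
Qed.

Lemma closed_full (G : sgraph) (p : seq G) : graph_connected G -> p != [::] ->
  (forall x y, x \in p -> adj x y -> y \in p) -> forall x, x \in p.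
Proof.
case: p => // v p G_conn _ p_closed x; have [q + ->] := G_conn v x.
suff H z : z \in v :: p -> path (@adj G) z q -> last z q \in v :: p by apply/H/mem_head.
by elim: q z => [|y q IH] z //= zp /andP[zy]; apply: IH; exact: p_closed zy.
Qed.

(** Either some edge leaves the given cycle and serves as pendant edge, or the cycle is Hamiltonian
    and a chord at a vertex of degree at least 3 yields a shorter cycle with a pendant edge. *)
Lemma exists_pattern (G : sgraph) k : graph_connected G -> has_cycle G -> 3 <= k ->
  (exists x (s : seq G), [/\ uniq s, size s = 3 & {in s, forall y, adj x y}]) ->
  exists g (b : nat -> G), pattern k g b.
Proof.
move=> G_conn [p p3 p_cycle] k3 [x [s [s_uniq s3 sx]]].
have p_rot v : v \in p -> exists q, [/\ perm_eq p (v :: q), path (@adj G) v q,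
    uniq (v :: q), adj v (last v q) & 2 <= size q].
  move=> /rot_to[i q pq]; exists q.
  have : ucycle (@adj G) (v :: q) by rewrite -pq /ucycle rot_cycle rot_uniq.
  have : size (v :: q) = size p by rewrite -pq size_rot.
  move=> /= sq /andP[]; rewrite /= rcons_path => /andP[vq vl] q_uniq.
  split=> //; [by rewrite -pq perm_sym perm_rot | by rewrite adj_sym | lia].
have [[v [w [vp wp vw]]]|noexit] := pselect (exists v w, [/\ v \in p, w \notin p & adj v w]).
  have [q [pq vq q_uniq vl q2]] := p_rot v vp.
  exists (size q).+1, (nth w (w :: v :: q)); apply: pattern_of_seq => //.
    by rewrite [uniq _]/= -(perm_mem pq) wp.
  by rewrite /= adj_sym vw.
(* As no edge leaves the cycle, connectedness puts every vertex on it. *)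
have xp : x \in p.
  apply: closed_full => [//||v w vp vw]; first by case: (p) p3.
  by apply: contrapT => /negP wp; apply: noexit; exists v, w.
have [q [pq xq q_uniq xl q2]] := p_rot x xp.
have inq y : adj x y -> y \in q.
  move=> xy; have : y \in p.
    by apply: contrapT => /negP wp; apply: noexit; exists x, y.
  by rewrite (perm_mem pq) inE => /orP[/eqP e|//]; rewrite e adj_irr in xy.
(* Among three neighbours of [x], one is not next to [x] on the cycle. *)
have [u us] := @seq_notin_exists _ s [:: head x q; last x q] s_uniq ltac:(by rewrite s3).
rewrite !inE negb_or => /andP[uh ul]; have xu := sx _ us; have := inq _ xu.
move=> /splitPr quq; case: quq xq q_uniq xl q2 uh ul {inq pq} => q1 q2 xq q_uniq xl qs uh ul.
have q1N : q1 <> [::] by move=> e; rewrite e /= eqxx in uh.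
have [q2' [z q2E]] : exists q2' z, q2 = rcons q2' z.
  case/lastP: q2 {xq q_uniq xl qs uh} ul => [|q2' z _]; last by exists q2', z.
  by rewrite last_cat /= eqxx.
subst q2; rewrite last_cat /= last_rcons in xl.
(* The chord [x u] cuts off the cycle [x, q1, u]; [z], the other cycle neighbour of [x], becomes the
   pendant vertex. *)
exists (size (rcons q1 u)).+1, (nth z (z :: x :: rcons q1 u)); apply: pattern_of_seq => //.
- move: q_uniq; rewrite -cat_rcons -rcons_cat -rcons_cons rcons_uniq.
  rewrite inE mem_cat !negb_or -cat_cons cat_uniq => /andP[/and3P[zx z1 _] /andP[x_uniq _]].
  by rewrite cons_uniq inE negb_or zx z1.
- rewrite /= adj_sym xl; move: xq; rewrite -cat_rcons cat_path => /andP[->] //.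
- by rewrite last_rcons.
- by rewrite size_rcons; case: q1 q1N {xq q_uniq xl qs uh ul}.
Qed.


(** * Subcubic graphs *)

Lemma isomorphic_complete (G : sgraph) n (s : seq G) : uniq s -> size s = n.+1 ->
  (forall x, x \in s) -> (forall x y : G, adj x y = (x != y)) ->
  isomorphic G (complete_graph n.+1).
Proof.
move=> s_uniq s_size s_full adjE; have lt x : index x s < n.+1 by rewrite -s_size index_mem.
exists (fun x => Ordinal (lt x) : complete_graph n.+1).
have f_inj : injective (fun x => Ordinal (lt x) : complete_graph n.+1).
  by move=> x y [] /(congr1 (nth x s)); rewrite !nth_index.
split; last first.
  by move=> x y; rewrite adjE /= /complete_adj (inj_eq f_inj).
have [x0 _] : exists x : G, True by case: (s) s_size => // x; exists x.
exists (fun i : 'I_n.+1 => nth x0 s i) => [x|i]; first by rewrite nth_index.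
by apply: val_inj; rewrite /= index_uniq// s_size.
Qed.

Lemma isomorphic_complete_bipartite (G : sgraph) m n (s t : seq G) :
  uniq (s ++ t) -> size s = m.+1 -> size t = n.+1 -> (forall x, x \in s ++ t) ->
  (forall x y : G, adj x y = ((x \in s) != (y \in s))) ->
  isomorphic G (complete_bipartite_graph m.+1 n.+1).
Proof.
rewrite cat_uniq => /and3P[s_uniq /hasPn st t_uniq] s_size t_size st_full adjE.
have [x0 _] : exists x : G, True by case: (s) s_size => // x; exists x.
pose f x : complete_bipartite_graph m.+1 n.+1 :=
  if x \in s then inl (inord (index x s)) else inr (inord (index x t)).
exists f; split; last first.
  by move=> x y; rewrite adjE /f /=; case: (x \in s); case: (y \in s).
exists (fun i : 'I_m.+1 + 'I_n.+1 => match i with inl i => nth x0 s i | inr i => nth x0 t i end).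
  move=> x; rewrite /f; case: (boolP (x \in s)) => xs.
    by rewrite inordK ?nth_index// -s_size index_mem.
  have xt : x \in t by have := st_full x; rewrite mem_cat (negbTE xs).
  by rewrite inordK ?nth_index// -t_size index_mem.
move=> [i|i]; rewrite /f.
  by rewrite mem_nth ?s_size// index_uniq ?s_size// inord_val.
have it : nth x0 t i \in t by rewrite mem_nth// t_size.
by rewrite (negbTE (st _ it)) index_uniq ?t_size// inord_val.
Qed.

(** Each product of two lists has four pairs. Take [p1 = (a, b)] with [a != b], and let [p2] and
    [p3] avoid both [(a, b)] and [(b, a)]. *)
Lemma K23_pair_choice (C : eqType) (l1 l1' l2 l2' l3 l3' : seq C) :
  let good l l' := uniq l /\ uniq l' /\ size l = 2 /\ size l' = 2 in
  good l1 l1' -> good l2 l2' -> good l3 l3' ->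
  exists p1 p2 p3 : C * C,
    [/\ p1.1 \in l1 /\ p1.2 \in l1', p2.1 \in l2 /\ p2.2 \in l2',
        p3.1 \in l3 /\ p3.2 \in l3', uniq [:: p1; p2; p3] &
        (p1.2, p1.1) \notin [:: p1; p2; p3]].
Proof.
move=> good [u1 [u1' [s1 s1']]] h2 h3.
have pick l l' (t : seq (C * C)) : good l l' -> size t < 4 ->
    exists2 p, p.1 \in l /\ p.2 \in l' & p \notin t.
  move=> [ul [ul' [sl sl']]] t4.
  have [||p] := @seq_notin_exists _ [seq (a, b) | a <- l, b <- l'] t.
  - by apply: allpairs_uniq => // -[? ?] [? ?] _ _ [-> ->].
  - by rewrite size_allpairs sl sl'.
  - by move=> /allpairsP[[a b] [al bl' ->]] pt; exists (a, b).
have [a al1] : exists a, a \in l1 by case: l1 s1 {u1} => // a l _; exists a; exact: mem_head.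
have [|b bl1] := @seq_notin_exists _ l1' [:: a] u1'; first by rewrite s1'.
rewrite inE => ba.
have [p2 p2l p2N] := pick l2 l2' [:: (a, b); (b, a)] h2 isT.
have [p3 p3l p3N] := pick l3 l3' [:: (a, b); (b, a); p2] h3 isT.
exists (a, b), p2, p3; split=> //=; move: p2N p3N.
  by rewrite !inE !negb_or => /andP[p2a _] /and3P[p3a _ p32]; rewrite !(eq_sym (a, b)) p2a p3a eq_sym p32.
rewrite !inE !negb_or => /andP[_ p2a] /and3P[_ p3a _].
by rewrite ![(b, a) == _]eq_sym p2a p3a !andbT; apply: contraNneq ba => -[->].
Qed.

(** Each vertex of [s] carries the pair of colours of its edges to [u] and [v]. Distinct pairs leave
    only the identity if [u] and [v] are fixed; they cannot be exchanged, since the reverse of the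
    first pair does not occur. *)
Lemma K23_distinguishing (G : sgraph) (C : Type) (L : edges G -> set C) (u v : G) (s : seq G) :
  (forall e, L e #= `I_2) -> size s = 3 -> uniq [:: u, v & s] -> (forall x, x \in [:: u, v & s]) ->
  (forall x, adj u x = (x \in s)) -> (forall x, adj v x = (x \in s)) ->
  {in s, forall m x, adj m x = (x \in [:: u; v])} ->
  exists c : edges G -> C, (forall e, L e (c e)) /\ distinguishing c.
Proof.
move=> L2 s3 uvs_uniq G_full uE vE sE; have [l [lC lP]] := exists_edge_seq L2.
case: s s3 uvs_uniq G_full uE vE sE => [|m1 [|m2 [|m3 []]]] // _.
set s := [:: m1; m2; m3] => uvs_uniq G_full uE vE sE.
have [/and3P[uN vN s_uniq]] := uvs_uniq.
have uv : u != v by move: uN; rewrite inE negb_or => /andP[].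
have us : u \notin s by move: uN; rewrite inE negb_or => /andP[].
have good m : m \in s -> uniq (l u m) /\ uniq (l v m) /\ size (l u m) = 2 /\ size (l v m) = 2.
  by move=> ms; have [? ? _] := lP u m ltac:(by rewrite uE); have [? ? _] := lP v m ltac:(by rewrite vE).
have [|||p1 [p2 [p3 [p1l p2l p3l p_uniq p_swap]]]] :=
    @K23_pair_choice _ (l u m1) (l v m1) (l u m2) (l v m2) (l u m3) (l v m3);
  [by apply: good; rewrite !inE eqxx ?orbT ..|].
pose pr m := nth p1 [:: p1; p2; p3] (index m s).
have pr_l m : m \in s -> (pr m).1 \in l u m /\ (pr m).2 \in l v m.
  move: s_uniq; rewrite /= !inE !negb_or andbT => /andP[/andP[m12 m13] m23].
  rewrite /pr /= => /or3P[]/eqP->; rewrite ?eqxx ?(negbTE m12) ?(negbTE m13) ?(negbTE m23) //=.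
have pr_inj : {in s &, injective pr}.
  move=> m m' ms m's /eqP; rewrite /pr nth_uniq ?index_mem// => /eqP/(congr1 (nth m s)).
  by rewrite !nth_index.
have pr_swap m : m \in s -> pr m <> ((pr m1).2, (pr m1).1).
  move=> ms; rewrite {2 3}/pr /= eqxx /= => e; move: p_swap; rewrite -e /pr.
  by rewrite mem_nth// index_mem.
pose col x y : C := if x \in s then (if y == u then (pr x).1 else (pr x).2)
  else (if x == u then (pr y).1 else (pr y).2).
have vs : v \notin s by [].
have col_u m : m \in s -> col u m = (pr m).1 by move=> ms; rewrite /col (negbTE us) eqxx.
have col_v m : m \in s -> col v m = (pr m).2.
  by move=> ms; rewrite /col (negbTE vs) eq_sym (negbTE uv).
have col_sym m x : m \in s -> x \in [:: u; v] -> col m x = col x m.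
  move=> ms; rewrite !inE => /orP[]/eqP->; rewrite ?col_u ?col_v// /col ms ?eqxx//.
  by rewrite eq_sym (negbTE uv).
have uuv : u \in [:: u; v] by rewrite inE eqxx.
have vuv : v \in [:: u; v] by rewrite !inE eqxx orbT.
have G_split x : (x = u \/ x = v) \/ x \in s.
  have := G_full x; rewrite -[[:: u, v & s]]/([:: u; v] ++ s) mem_cat => /orP[xuv|]; last by right.
  by left; move: xuv; rewrite !inE => /orP[]/eqP; [left|right].
have colP x y : adj x y -> (x \in s /\ y \in [:: u; v]) \/ (y \in s /\ x \in [:: u; v]).
  case: (G_split x) => [[]->|xs]; rewrite ?uE ?vE ?sE// => ys; [right|right|left]; by split.
have col_l x m : x \in [:: u; v] -> m \in s -> col x m \in l x m.
  move=> + ms; have [h1 h2] := pr_l _ ms.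
  by rewrite !inE => /orP[]/eqP->; rewrite ?col_u ?col_v.
apply: (@exists_colouring G C L col) => [x y /colP[[xs yuv]|[ys xuv]]|x y xy|f [f_bij f_adj] f_col].
- exact: col_sym.
- exact: esym (col_sym _ _ ys xuv).
- have [_ _] := lP _ _ xy; apply; case: (colP _ _ xy) => -[ms xuv]; last exact: col_l.
  by rewrite col_sym// lC col_l.
have f_inj := bij_inj f_bij.
(* A vertex with three neighbours cannot be sent into [s], whose vertices have only two. *)
have f_center x : x \in [:: u; v] -> f x = u \/ f x = v.
  move=> xuv; case: (G_split (f x)) => [//|fxs].
  have xE m : m \in s -> adj x m.
    by move=> ms; move: xuv; rewrite !inE => /orP[]/eqP->; rewrite ?uE ?vE.
  have : size (map f s) <= size [:: u; v].
    apply: uniq_leq_size; first by rewrite map_inj_uniq.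
    by move=> _ /mapP[m ms ->]; rewrite -(sE _ fxs) f_adj xE.
  by [].
have f_s m : m \in s -> f m \in s.
  move=> ms; have [fu|fu] := f_center _ uuv.
    by rewrite -uE -fu f_adj uE.
  by rewrite -vE -fu f_adj uE.
have f_colu m : m \in s -> col (f u) (f m) = (pr m).1 by move=> ms; rewrite f_col ?uE// col_u.
have f_colv m : m \in s -> col (f v) (f m) = (pr m).2 by move=> ms; rewrite f_col ?vE// col_v.
have [fu|fu] := f_center _ uuv; have [fv|fv] := f_center _ vuv.
- by move: uv; rewrite -(inj_eq f_inj) fu fv eqxx.
- move=> x; case: (G_split x) => [[]->//|xs].
  apply: pr_inj; rewrite ?f_s//; have := f_colu _ xs; have := f_colv _ xs.
  by rewrite fu fv col_u ?col_v ?f_s//; case: (pr (f x)) (pr x) => [? ?] [? ?] /= -> ->.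
- have m1s : m1 \in s by exact: mem_head.
  exfalso; apply: (pr_swap (f m1)); first exact: f_s.
  have := f_colu _ m1s; have := f_colv _ m1s.
  by rewrite fu fv col_u ?col_v ?f_s//; case: (pr (f m1)) => [? ?] /= -> ->.
- by move: uv; rewrite -(inj_eq f_inj) fu fv eqxx.
Qed.


(** If every cycle with a pendant edge has the forbidden chord, these chords together with the
    degree bound determine the graph. *)
Lemma subcubic_pattern_or_K23 (G : sgraph) (g : nat) (b : nat -> G) :
  graph_connected G ->
  (forall (x : G) (s : seq G), uniq s -> {in s, forall y, adj x y} -> size s <= 3) ->
  ~ isomorphic G (complete_bipartite_graph 3 3) -> ~ isomorphic G (complete_graph 4) ->
  pattern 3 g b ->
  (exists g b', @pattern G 2 g b') \/
  (exists (u v : G) (s : seq G), size s = 3 /\ uniq [:: u, v & s] /\ (forall x, x \in [:: u, v & s]) /\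
    (forall x, adj u x = (x \in s)) /\ (forall x, adj v x = (x \in s)) /\
    {in s, forall m x, adj m x = (x \in [:: u; v])}).
Proof.
move=> G_conn deg3 noK33 noK4 b_pat.
have [|nopat] := pselect (exists g b', @pattern G 2 g b'); [by left | right].
have weak g' b' : @pattern G 3 g' b' -> adj (b' 0) (b' g'.-1).
  move=> [b'_inj b'_adj b'1 g'3 _]; apply: contrapT => /negP nadj.
  by apply: nopat; exists g', b'; split; rewrite ?nadj.
have nbr3 (x a1 a2 a3 : G) : uniq [:: a1; a2; a3] -> adj x a1 -> adj x a2 -> adj x a3 ->
    forall y, adj x y = (y \in [:: a1; a2; a3]).
  move=> a_uniq x1 x2 x3 y; apply/idP/idP => [xy|]; last by rewrite !inE => /or3P[]/eqP->.
  apply: contrapT => /negP ya.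
  suff : size [:: y; a1; a2; a3] <= 3 by [].
  apply: (deg3 x); first by rewrite cons_uniq ya.
  by move=> z; rewrite inE => /orP[/eqP->//|]; rewrite !inE => /or3P[]/eqP->.
(* Going round the triangle in both directions joins [w] to all of it; with degrees at most 3 the
   graph is then [K_4]. *)
have tri (w a1 a2 a3 : G) : uniq [:: w; a1; a2; a3] -> adj w a1 -> adj a1 a2 -> adj a2 a3 ->
    adj a1 a3 -> False.
  move=> a_uniq w1 a12 a23 a13.
  have w2 : adj w a2.
    have := @weak _ _ (@pattern_of_seq G 3 w a1 [:: a2; a3] isT a_uniq _ a13 isT).
    by rewrite /= w1 a12 a23; apply.
  have w3 : adj w a3.
    have := @weak _ _ (@pattern_of_seq G 3 w a1 [:: a3; a2] isT _ _ a12 isT).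
    rewrite /= w1 a13 adj_sym a23; apply=> //.
    by move: a_uniq; rewrite /= !inE !negb_or (eq_sym a2 a3) => /and4P[/and3P[-> -> ->] /andP[-> ->] ->].
  have s_adj : {in [:: w; a1; a2; a3] &, forall x y, x != y -> adj x y}.
    move=> x y; rewrite !inE => /or4P[]/eqP-> /or4P[]/eqP->; rewrite ?eqxx// => _ //; by rewrite adj_sym.
  have s_full x : x \in [:: w; a1; a2; a3].
    apply: closed_full => // {}x y xs xy.
    apply: contrapT => /negP ys.
    have sz : size (rem x [:: w; a1; a2; a3]) = 3 by rewrite size_rem.
    suff : (size (rem x [:: w; a1; a2; a3])).+1 <= 3 by rewrite sz.
    apply: (deg3 x (y :: rem x [:: w; a1; a2; a3])).
      rewrite cons_uniq rem_uniq// andbT; apply: contra ys; exact: mem_rem.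
    move=> z; rewrite inE mem_rem_uniq// inE => /orP[/eqP->//|/andP[zx zs]].
    by apply: s_adj => //; rewrite eq_sym.
  apply: noK4; apply: (isomorphic_complete a_uniq _ s_full) => // x y.
  apply/idP/idP => [xy|xy]; last exact: s_adj (s_full x) (s_full y) xy.
  by apply: contraTneq xy => ->; rewrite adj_irr.
have quad (w a1 a2 a3 a4 : G) : uniq [:: w; a1; a2; a3; a4] -> adj w a1 -> adj a1 a2 ->
    adj a2 a3 -> adj a3 a4 -> adj a1 a4 -> adj w a3.
  move=> a_uniq w1 a12 a23 a34 a14.
  have := @weak _ _ (@pattern_of_seq G 3 w a1 [:: a2; a3; a4] isT a_uniq _ a14 isT).
  by rewrite /= w1 a12 a23 a34; apply.
(* A third neighbour [z] of [m1] would, by [quad] on the 4-cycles through [m1], be adjacent to [m2]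
   and [m3] too, giving [K_{3,3}]. *)
have mid (u v m1 m2 m3 : G) : uniq [:: u; v; m1; m2; m3] ->
    adj u m1 -> adj u m2 -> adj u m3 -> adj v m1 -> adj v m2 -> adj v m3 ->
    forall z, adj m1 z = (z \in [:: u; v]).
  move=> /[dup] all_uniq; rewrite /= !inE !negb_or.
  move=> /and5P[/and4P[uv um1 um2 um3] /and3P[vm1 vm2 vm3] /andP[m12 m13] m23 _].
  move=> u1 u2 u3 v1 v2 v3 z.
  apply/idP/idP => [m1z|]; last by rewrite !inE => /orP[]/eqP->; rewrite adj_sym.
  apply: contrapT => /negP; rewrite !inE negb_or => /andP[zu zv].
  have zm1 : z != m1 by apply: contraTneq m1z => ->; rewrite adj_irr.
  have zm2 : z != m2.
    apply/eqP => zm2; rewrite zm2 in m1z; apply: (@tri m3 u m1 m2) => //; last by rewrite adj_sym.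
    by rewrite /= !inE !negb_or ![m3 == _]eq_sym um1 um2 um3 m12 m13 m23.
  have zm3 : z != m3.
    apply/eqP => zm3; rewrite zm3 in m1z; apply: (@tri m2 u m1 m3) => //; last by rewrite adj_sym.
    by rewrite /= !inE !negb_or (eq_sym m2 u) (eq_sym m2 m1) um1 um2 um3 m12 m13 m23.
  have z2 : adj z m2.
    apply: (@quad z m1 v m2 u) => //; try by rewrite adj_sym.
    by rewrite /= !inE !negb_or zm1 zv zm2 zu ![m1 == _]eq_sym vm1 ?(eq_sym m2 m1) m12 um1 vm2 (eq_sym v u) uv (eq_sym m2 u) um2.
  have z3 : adj z m3.
    apply: (@quad z m1 v m3 u) => //; try by rewrite adj_sym.
    by rewrite /= !inE !negb_or zm1 zv zm3 zu ![m1 == _]eq_sym vm1 ?(eq_sym m3 m1) m13 um1 vm3 (eq_sym v u) uv (eq_sym m3 u) um3.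
  have z1 : adj z m1 by rewrite adj_sym.
  pose s := [:: u; v; z]; pose t := [:: m1; m2; m3].
  have t_uniq : uniq t by rewrite /= !inE !negb_or m12 m13 m23.
  have s_uniq : uniq s by rewrite /= !inE !negb_or uv (eq_sym u) zu (eq_sym v) zv.
  have sE x : x \in s -> forall y, adj x y = (y \in t).
    by rewrite !inE => /or3P[]/eqP->; apply: (nbr3 _ _ _ _ t_uniq).
  have tE x : x \in t -> forall y, adj x y = (y \in s).
    by rewrite !inE => /or3P[]/eqP->; apply: (nbr3 _ _ _ _ s_uniq); rewrite adj_sym.
  have st_full x : x \in s ++ t.
    apply: closed_full => // {}x y; rewrite !mem_cat => /orP[/sE->->|/tE->->//]; exact: orbT.
  have st_uniq : uniq (s ++ t).
    rewrite cat_uniq s_uniq t_uniq andbT; apply/hasPn => x xt; apply/negP => xs.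
    by have := sE _ xs x; rewrite xt adj_irr.
  apply: noK33; apply: (isomorphic_complete_bipartite st_uniq _ _ st_full) => // x y.
  have out w : (w \in t) = (w \notin s).
    have := st_full w; rewrite mem_cat; case: (boolP (w \in s)) => // ws _.
    by apply/negbTE/negP => wt; have := sE _ ws w; rewrite wt adj_irr.
  case: (boolP (x \in s)) => xs; first by rewrite sE// out; case: (y \in s).
  by rewrite tE ?out//; case: (y \in s).
have [w [a1 [a2 [a3 [a4 [a_uniq [w1 a12 a23 a34 a14]]]]]]] : exists w a1 a2 a3 a4 : G,
    uniq [:: w; a1; a2; a3; a4] /\ [/\ adj w a1, adj a1 a2, adj a2 a3, adj a3 a4 & adj a1 a4].
  have [b_inj b_adj b1g g3 _] := b_pat.
  have b_uniq (t : seq nat) : uniq t -> all (fun i => i <= g) t -> uniq (map b t).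
    move=> t_uniq /allP tg; rewrite map_inj_in_uniq// => i j it jt.
    by apply: b_inj; exact: tg.
  have [g4|g5] := leqP g 4.
    have [g3'|g4'] : g = 3 \/ g = 4 by lia.
      exfalso; rewrite g3' in b1g; apply: (tri (b 0) (b 1) (b 2) (b 3)); rewrite ?b_adj//; try lia.
      by apply: (b_uniq [:: 0; 1; 2; 3]) => //=; lia.
    rewrite g4' in b1g; exists (b 0), (b 1), (b 2), (b 3), (b 4).
    split; first by apply: (b_uniq [:: 0; 1; 2; 3; 4]) => //=; lia.
    by split; rewrite ?b_adj//; lia.
  (* The same cycle traversed the other way ends in [b 3, b 2], so its forbidden chord is [b 0 b 3];
     this creates the 4-cycle [b 1, b 2, b 3, b 0] with pendant vertex [b g]. *)
  have b03 : adj (b 0) (b 3).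
    have := weak g (fun i => if i <= 1 then b i else b (g + 2 - i)).
    have -> : (g.-1 <= 1) = false by lia.
    have -> : g + 2 - g.-1 = 3 by lia.
    apply; split=> // [i j ig jg|i ig|].
    - by case: ifP => i1; case: ifP => j1 => /b_inj; lia.
    - case: ifP => i1; last first.
        have -> : (i < 1) = false by lia.
        have -> : g + 2 - i = (g + 2 - i.+1).+1 by lia.
        by rewrite adj_sym b_adj//; lia.
      case: ltnP => i2; first by rewrite b_adj//; lia.
      have -> : i = 1 by lia.
      by have -> : g + 2 - 2 = g by lia.
    - have -> : (g <= 1) = false by lia.
      have -> : g + 2 - g = 2 by lia.
      by rewrite b_adj//; lia.
  exists (b g), (b 1), (b 2), (b 3), (b 0); split.
    by apply: (b_uniq [:: g; 1; 2; 3; 0]) => /=; rewrite ?inE; lia.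
  split; rewrite ?b_adj//; rewrite 1?adj_sym//; try lia.
  by rewrite b_adj//; lia.
(* Now [w], [a2] and [a4] are common neighbours of [a1] and [a3], and [mid] leaves them no others:
   the graph is [K_{2,3}]. *)
have w3 : adj w a3 by exact: quad a_uniq _ _ _ _ _.
exists a1, a3, [:: w; a2; a4].
have all_uniq : uniq [:: a1; a3; w; a2; a4].
  move: a_uniq; rewrite /= !inE !negb_or (eq_sym w a1) (eq_sym w a3) (eq_sym a2 a3).
  by move=> /and5P[/and4P[-> -> -> ->] /and3P[-> -> ->] /andP[-> ->] ->].
have a2_uniq : uniq [:: a1; a3; a2; w; a4].
  by move: all_uniq; rewrite /= !inE !negb_or (eq_sym a2 w) => /and5P[/and4P[-> -> -> ->] /and3P[-> -> ->] /andP[-> ->] ->].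
have a4_uniq : uniq [:: a1; a3; a4; w; a2].
  by move: all_uniq; rewrite /= !inE !negb_or (eq_sym a4 w) (eq_sym a4 a2) => /and5P[/and4P[-> -> -> ->] /and3P[-> -> ->] /andP[-> ->] ->].
have s_uniq : uniq [:: w; a2; a4] by move: all_uniq; rewrite 2!cons_uniq => /and3P[].
have [a1w a3w a32] : [/\ adj a1 w, adj a3 w & adj a3 a2] by rewrite !(adj_sym _ w) (adj_sym a3 a2).
have uE x : adj a1 x = (x \in [:: w; a2; a4]) by exact: nbr3.
have vE x : adj a3 x = (x \in [:: w; a2; a4]) by exact: nbr3.
have sE : {in [:: w; a2; a4], forall m x, adj m x = (x \in [:: a1; a3])}.
  move=> m; rewrite !inE => /or3P[]/eqP->.
  - exact: mid all_uniq _ _ _ _ _ _.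
  - exact: mid a2_uniq _ _ _ _ _ _.
  - exact: mid a4_uniq _ _ _ _ _ _.
do 2!split=> //; split; last by [].
apply: closed_full => // x y; rewrite -[[:: a1, a3 & _]]/([:: a1; a3] ++ [:: w; a2; a4]) !mem_cat.
move=> /orP[|/sE->->//]; rewrite !inE => /orP[]/eqP->; rewrite ?uE ?vE !inE => ->; exact: orbT.
Qed.

(** * Degrees and the two cases of the theorem *)

Lemma exists_uniq_seq (T : eqType) (A : set T) n : ~ (A #<= `I_n) ->
  exists s : seq T, [/\ uniq s, size s = n.+1 & {in s, forall x, A x}].
Proof.
move=> An; suff ex m : m <= n.+1 ->
    exists s : seq T, [/\ uniq s, size s = m & {in s, forall x, A x}] by exact: ex.
elim: m => [|m IH] mn; first by exists [::].
have [s [s_uniq s_size sA]] := IH (ltnW mn).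
have [[x Ax xs]|nx] := pselect (exists2 x, A x & x \notin s).
  exists (x :: s); split; rewrite /= ?xs ?s_size// => y; rewrite inE => /orP[/eqP->//|].
  exact: sA.
have As x : A x -> x \in s by move=> Ax; apply: contrapT => /negP xs; apply: nx; exists x.
exfalso; apply: An; apply: (@card_le_injfun _ _ _ _ (index^~ s)) => [x Ax|x y /As xs /As ys].
  by rewrite /= (leq_trans _ (mn : m <= n))// -s_size index_mem As.
by move=> /(congr1 (nth x s)); rewrite !nth_index.
Qed.

(** Otherwise 2 would bound all degrees and hence their supremum [D]. *)
Lemma exists_vertex_degree3 (G : sgraph) (D : Type) :
  is_max_degree G D -> `I_3 #<= [set: D] ->
  exists x (s : seq G), [/\ uniq s, size s = 3 & {in s, forall y, adj x y}].
Proof.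
move=> [_ D_sup] D3; apply: contrapT => nx.
have /(card_le_trans D3) : [set: D] #<= [set: 'I_2].
  apply: D_sup => x; rewrite -(card_le_eqr card_II); apply: contrapT => /exists_uniq_seq[s sP].
  by apply: nx; exists x, s.
by rewrite -(card_le_eqr card_II) card_le_II.
Qed.

Lemma finite_degree_distinguishing (G : sgraph) (C : Type) (L : edges G -> set C) k :
  graph_connected G -> has_cycle G -> 2 <= k -> (forall x : G, neighbours x #<= `I_k.+1) ->
  (exists x (s : seq G), [/\ uniq s, size s = 3 & {in s, forall y, adj x y}]) ->
  ~ isomorphic G (complete_bipartite_graph 3 3) -> ~ isomorphic G (complete_graph 4) ->
  (forall e, L e #= `I_k) ->
  exists c : edges G -> C, (forall e, L e (c e)) /\ distinguishing c.
Proof.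
move=> G_conn G_cycle k2 degk deg3 noK33 noK4 Lk.
have [k3|k3] := leqP 3 k.
  have [g [b b_pat]] := exists_pattern G_conn G_cycle k3 deg3.
  exact: pattern_distinguishing b_pat.
have {k2 k3}kE : k = 2 by lia.
(* The parameter 3 in place of [k = 2] first gives a pattern with no condition on the chord. *)
subst k; have [g [b b_pat]] := exists_pattern G_conn G_cycle (leqnn 3) deg3.
have [N [_ NP N_size]] := exists_neighbour_seq degk.
have [x s s_uniq sx|[g' [b' b'_pat]]|] := subcubic_pattern_or_K23 G_conn _ noK33 noK4 b_pat.
- by apply: leq_trans (N_size x); apply: uniq_leq_size => // y /sx; rewrite NP.
- exact: pattern_distinguishing b'_pat.
- by move=> [u [v [s [s3 [s_uniq [s_full [uE [vE sE]]]]]]]]; exact: K23_distinguishing sE.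
Qed.

Unset Implicit Arguments.

Theorem theorem4 (G : sgraph) (D K : Type)
    (G_connected : graph_connected G)
    (D_max_degree : is_max_degree G D)
    (D_ge3 : `I_3 #<= [set: D])
    (K_pred : is_pred_cardinal D K)
    (G_not_tree : ~ is_tree G)
    (G_not_K33 : ~ isomorphic G (complete_bipartite_graph 3 3))
    (G_not_K4 : ~ isomorphic G (complete_graph 4)) :
  (exists2 I : Type, is_list_distinguishing_index G I & [set: I] #<= [set: K])
  /\
  (forall (C : Type) (L : edges G -> set C),
     (forall e : edges G, L e #= [set: K]) ->
     exists c : edges G -> C,
       (forall e : edges G, L e (c e)) /\ distinguishing c).
Proof.
suff distK : list_distinguishable G K.
  by split=> //; exact: exists_list_distinguishing_index.
move=> C L LK; have deg3 := exists_vertex_degree3 D_max_degree D_ge3.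
have [/finite_setP[n Dn]|Doo] := pselect (finite_set [set: D]).
  have Kn := K_pred.1 n Dn; have n3 : 3 <= n by move: D_ge3; rewrite (card_le_eqr Dn) card_le_II.
  have nE : n.-1.+1 = n by lia.
  (* The lists have [k = n - 1] colours, so the degree bound [n] is [k + 1]. *)
  apply: (@finite_degree_distinguishing G C L n.-1) => //; [|lia| |].
  - by apply: contrapT => no_cycle; apply: G_not_tree.
  - by move=> x; rewrite nE -(card_le_eqr Dn); exact: D_max_degree.1.
  - by move=> e; exact: card_eq_trans (LK e) Kn.
have [r [[|a [|b s]] [s_uniq //= _ rs]]] := deg3.
apply: (@infinite_degree_distinguishing G D C L r a b) => //.
- exact: D_max_degree.1.
- move=> e; rewrite (card_le_eqr (LK e)) (card_le_eqr (K_pred.2 Doo)); exact: card_lexx.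
- by apply: rs; rewrite mem_head.
- by apply: rs; rewrite !inE eqxx orbT.
- by move: s_uniq; rewrite /= inE negb_or => /andP[/andP[]].
Qed.
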